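(* Fix $n\geq 1$. Assume the following two conjectures. (Zmiaikou's conjecture) For any $m\geq 7$ there are exactly two $\mathrm{SL}(2,\mathbb{Z})$-orbits of primitive $m$-squared origamis in $\mathcal{H}(1,1)$; one consists of origamis with monodromy group $\mathrm{Alt}(m)$ and has cardinality $\mathcal{A}_m$, the other consists of origamis with monodromy group $\mathrm{Sym}(m)$ and has cardinality $\mathcal{S}_m$, where, with $P_m=\prod_{p\mid m,\,p\text{ prime}}(1-p^{-2})$, for $m$ odd $\mathcal{A}_m=\frac{1}{24}m^2(m-3)(m-5)P_m$ and $\mathcal{S}_m=\frac18 m^2(m-1)(m-3)P_m$, and for $m$ even $\mathcal{A}_m=\frac{1}{24}m^3(m-2)P_m$ and $\mathcal{S}_m=\frac18 m^2(m-2)(m-4)P_m$. (Parity Conjecture) Provided that $(d,n)\neq(2,1),(3,1),(4,1),(5,1)$, the locus $W_{d^2}[n]$ is irreducible when $n$ is even, and consists of two irreducible components when $n$ is odd (exactly $W_{d^2}^{\epsilon}[n]$ for $\epsilon\in\{0,1\}$). Then the genus of $W_{d^{2}}[n]$ (of each of its irreducible components) goes to infinity as $d$ goes to infinity.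
   Context: An origami is a translation surface $(M,\pi^{*}(dz))$ where $M$ is a connected compact Riemann surface and $\pi:M\to\mathbb{T}^2=\mathbb{C}/(\mathbb{Z}\oplus i\mathbb{Z})$ is a finite cover possibly branched only over $0$; it is $N$-squared if $\deg\pi=N$. Equivalently it is a pair $(h,v)\in \mathrm{Sym}(N)^2$ generating a transitive subgroup (its monodromy group), up to simultaneous conjugation. It is primitive if it is not a cover of another origami different from itself or the unit-square torus. $\mathrm{SL}(2,\mathbb{Z})\subset\mathrm{SL}(2,\mathbb{R})$ acts on origamis by post-composition of the translation charts with the linear action on $\mathbb{R}^2=\mathbb{C}$. $\mathcal{H}(1,1)$ is the moduli space of genus two translation surfaces with two simple zeros. Loci: for $d\ge2$, $n\ge1$, $W_{d^2}[n]\subset\mathcal{M}_2$ is the locus of genus two curves $X$ for which there exist a primitive (i.e. with no intermediate covers) degree $d$ cover $\pi:X\to E$ of an elliptic curve $E$ and critical points $x_1\neq x_2$ of $\pi$ in $X$ such that $\pi(x_1)-\pi(x_2)\in\mathrm{Jac}(E)$ is an $n$-torsion point of order exactly $n$. Its components are the projections to $\mathcal{M}_2$ of $\mathrm{SL}(2,\mathbb{R})$-orbits of $dn$-squared origamis $(M,\omega)\in\mathcal{H}(1,1)$ that admit a primitive degree $d$ cover of an $n$-squared torus; precisely, with relative period group $\mathrm{RPer}(\omega)=\mathbb{Z}\oplus i\mathbb{Z}$ and absolute period group $\mathrm{Per}(\omega)$ of index $n$ in it (for $n=1$, the primitive $d$-squared origamis). Each component is a Teichmüller curve $\mathbb{H}/\mathrm{SL}(X,\omega)$,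 with $\mathrm{SL}(X,\omega)$ the stabiliser in $\mathrm{SL}(2,\mathbb{Z})$ of such an origami; its genus is that of the surface obtained by filling in the cusps. HLK-invariant: for an origami $(M,\omega)\to(\mathbb{T}^2,dz)$ with an involution $\iota$ of $M$ taking $\omega$ to $-\omega$, let $l_0$ be the number of fixed points of $\iota$ over $0$ and $l_1,l_2,l_3$ the numbers over the other three $2$-torsion points of $\mathbb{T}^2$; the HLK-invariant is $(l_0,[l_1,l_2,l_3])$ with $[l_1,l_2,l_3]$ unordered. For $n$ odd, $W_{d^2}^{0}[n]$ is the part of $W_{d^2}[n]$ coming from such origamis with HLK-invariant $(3,[1,1,1])$ ($d$ odd) or $(0,[2,2,2])$ ($d$ even), and $W_{d^2}^{1}[n]$ the part coming from those with HLK-invariant $(1,[3,1,1])$ ($d$ odd) or $(2,[2,2,0])$ ($d$ even). *)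

(* Defs.v *)
From mathcomp Require Import all_boot all_order all_algebra.
From mathcomp Require Import all_fingroup all_solvable.
From mathcomp Require Import boolp classical_sets cardinality.

Set Implicit Arguments.
Unset Strict Implicit.
Unset Printing Implicit Defensive.

Import GRing.Theory Num.Theory.

(* An N-squared origami is a pair (h, v) of permutations of its unit squares,
   h(i) being the right neighbour and v(i) the top neighbour of the square i,
   generating a transitive group; it is taken up to simultaneous conjugation.
   Products of permutations are read from left to right, as paths are. *)

Notation sqpair N := ({perm 'I_N} * {perm 'I_N})%type.

Section Origami.
Variable N : nat.
Implicit Types o : sqpair N.

Definition monodromy o : {group {perm 'I_N}} := <<[set o.1; o.2]>>%G.

Definition origamis : {set sqpair N} :=
  [set o | [transitive monodromy o, on [set: 'I_N] | 'P]]%SET.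

Definition conj_pair o (s : {perm 'I_N}) : sqpair N := (o.1 ^ s, o.2 ^ s)%g.

Definition iso_class o : {set sqpair N} :=
  [set conj_pair o s | s : {perm 'I_N}]%SET.

(* The path right, up, left, down: it turns once around the top-right corner of
   the square it starts from.  So the points of M over 0 are the cycles of
   [corner o], a k-cycle being a zero of order k - 1. *)
Definition corner o : {perm 'I_N} := (o.1 * o.2 * o.1^-1 * o.2^-1)%g.

(* H(1,1): exactly two zeros, both simple. *)
Definition in_H11 o : bool :=
  perm_eq [seq #|pred_of_set C| | C <- enum (porbits (corner o)) & 1 < #|pred_of_set C|]
          [:: 2; 2].

End Origami.

(* The origami o covers the origami o' (compatibly with the projections to the
   unit-square torus).  By transitivity of o', the map f on squares is onto. *)
Definition origami_cover (N N' : nat) (o : sqpair N) (o' : sqpair N')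
    (f : 'I_N -> 'I_N') : Prop :=
  (forall i, f (o.1 i) = o'.1 (f i)) /\ (forall i, f (o.2 i) = o'.2 (f i)).

(* A cover is an isomorphism iff N' = N, and N' = 1 is the unit-square torus. *)
Definition primitive_origami (N : nat) (o : sqpair N) : Prop :=
  forall (N' : nat) (o' : sqpair N') (f : 'I_N -> 'I_N'),
    o' \in origamis N' -> origami_cover o o' f -> N' = 1 \/ N' = N.

Definition mx2 (a b c d : int) : 'M[int]_2 :=
  (\matrix_(i, j) nth 0 (nth [::] [:: [:: a; b]; [:: c; d]] i) j)%R.

Definition mxT : 'M[int]_2 := mx2 1 1 0 1.
Definition mxS : 'M[int]_2 := mx2 0 (-1)%R 1 0.
Definition mxR : 'M[int]_2 := mx2 1 (-1)%R 1 0.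

Definition SL2Z : set 'M[int]_2 := [set A | (\det A)%R = 1%R]%classic.

(* [sl2z_act A o o'] : the origami A.o is (isomorphic to) o'.  The right and top
   neighbours in A.o are given by the monodromy in o along A^-1 e1 and A^-1 e2.
   For A = T = [1 1; 0 1] these are e1 and e2 - e1; for A = S = [0 -1; 1 0] they
   are -e2 and e1.  S and T generate SL(2,Z), even as a monoid, S and ST being of
   finite order. *)
Inductive sl2z_act (N : nat) : 'M[int]_2 -> sqpair N -> sqpair N -> Prop :=
| sl2z_act_iso o s : sl2z_act 1%:M%R o (conj_pair o s)
| sl2z_act_T o : sl2z_act mxT o (o.1, o.2 * o.1^-1)%g
| sl2z_act_S o : sl2z_act mxS o (o.2^-1, o.1)%g
| sl2z_act_mul A B o o' o'' :
    sl2z_act B o o' -> sl2z_act A o' o'' -> sl2z_act (A *m B)%R o o''.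

(* SL(X, omega) *)
Definition SL_stab (N : nat) (o : sqpair N) : set 'M[int]_2 :=
  [set A | sl2z_act A o o]%classic.

(* Orbits consist of isomorphism classes, so that their cardinality counts
   origamis up to isomorphism. *)
Definition sl2z_orbit (N : nat) (o : sqpair N) : {set {set sqpair N}} :=
  [set iso_class o' | o' : sqpair N & `[< exists A, sl2z_act A o o' >]]%SET.

(* The surface obtained from H / Gamma by filling in the cusps is triangulated.
   Let rho = exp(i pi / 3).  The images under SL(2,Z) of the hyperbolic triangle
   (i, rho, oo) and of its mirror image in the imaginary axis triangulate H with
   its cusps.  The vertices of this triangulation form the three SL(2,Z)-orbits of
   i, rho and oo, with stabilisers <S>, <R> and <-1, T>; its edges form the orbits
   of [i, rho], [rho, oo] and [i, oo], and its faces those of the two triangles,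
   all with stabiliser {1, -1}.  The cells of the quotient by Gamma that lie in the
   SL(2,Z)-orbit of a cell with stabiliser K are the double cosets
   Gamma A K, A in SL(2,Z). *)

Definition pm_powers (A : 'M[int]_2) : set 'M[int]_2 :=
  [set B | exists k : int, B = A ^ k \/ B = - (A ^ k)]%R%classic.

Definition double_cosets (Gamma K : set 'M[int]_2) : set (set 'M[int]_2) :=
  [set [set (g *m A *m k)%R | g in Gamma & k in K] | A in SL2Z]%classic.

Definition filled_euler_char (Gamma : set 'M[int]_2) (chi : int) : Prop :=
  exists v2 v3 voo t : nat,
    [/\ (double_cosets Gamma (pm_powers mxS) #= `I_v2)%card,
        (double_cosets Gamma (pm_powers mxR) #= `I_v3)%card,
        (double_cosets Gamma (pm_powers mxT) #= `I_voo)%card,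
        (double_cosets Gamma (pm_powers 1) #= `I_t)%card
      & chi = ((v2 + v3 + voo)%:Z - (3 * t)%:Z + (2 * t)%:Z)%R].

Definition has_genus (Gamma : set 'M[int]_2) (g : nat) : Prop :=
  filled_euler_char Gamma (2 - (2 * g)%:Z)%R.

(* Periods x + iy are encoded as pairs (x, y). *)

Definition subgroup_generated (V : zmodType) (G : set V) : set V :=
  smallest [set H : set V | H 0%R /\ forall x y, H x -> H y -> H (x - y)%R]%classic G.

Definition has_index (V : zmodType) (H G : set V) (n : nat) : Prop :=
  (H `<=` G)%classic /\
  ([set [set y | H (y - x)%R] | x in G]%classic #= `I_n)%card.

Section Periods.
Variables (N : nat) (o : sqpair N).

(* [walk i j z] : some path on the surface from the square i to the square j
   avoiding the corners has displacement z. *)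
Inductive walk (i : 'I_N) : 'I_N -> int * int -> Prop :=
| walk_nil : walk i i 0%R
| walk_right j z : walk i j z -> walk i (o.1 j) (z + (1, 0))%R
| walk_left j z : walk i (o.1 j) z -> walk i j (z - (1, 0))%R
| walk_up j z : walk i j z -> walk i (o.2 j) (z + (0, 1))%R
| walk_down j z : walk i (o.2 j) z -> walk i j (z - (0, 1))%R.

Definition Per : set (int * int) :=
  subgroup_generated [set z | exists i, walk i i z]%classic.

(* The top-right corner of the square i is a zero of omega iff corner o i != i;
   the displacement between two squares is that between their top-right corners. *)
Definition RPer : set (int * int) :=
  subgroup_generated
    [set z | exists i j, [/\ corner o i != i, corner o j != j & walk i j z]]%classic.

End Periods.

Section HLK.
Variables (N : nat) (o : sqpair N).

(* An involution taking omega to -omega sends the square i to the square s i,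
   rotating it by a half-turn.  (It preserves the fibre over 0, as it permutes the
   zeros of omega, which in H(1,1) exist and lie over 0.) *)
Definition half_turn (s : {perm 'I_N}) : bool :=
  [&& s * s == 1, o.1 ^ s == o.1^-1 & o.2 ^ s == o.2^-1]%g.

(* The top-right corner of i is sent to the bottom-left corner of s i, which is the
   top-right corner of the square to the left of, then below, s i. *)
Definition hlk_l0 (s : {perm 'I_N}) : nat :=
  #|[set C in porbits (corner o) | (s * o.1^-1 * o.2^-1)%g @: pred_of_set C == C]%SET|.

(* Fixed points over the midpoints of the vertical edges, over those of the
   horizontal edges, and over the centres of the squares. *)
Definition hlk_l123 (s : {perm 'I_N}) : seq nat :=
  [:: #|[set i | s i == o.1 i]%SET|; #|[set i | s i == o.2 i]%SET|;
      #|[set i | s i == i]%SET|].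

Definition has_HLK (l0 : nat) (l : seq nat) : bool :=
  [exists s, [&& half_turn s, hlk_l0 s == l0 & perm_eq (hlk_l123 s) l]].

End HLK.

Section Loci.
Variables d n : nat.

(* Such an origami has the cover M -> C / Per(omega) of degree d of an n-squared
   torus, which is primitive. *)
Definition W_origamis : {set sqpair (d * n)} :=
  [set o in origamis (d * n) | in_H11 o &&
     `[< RPer o = [set: int * int]%classic /\ has_index (Per o) (RPer o) n >]]%SET.

(* A component of W_{d^2}[n], i.e. the projection to M_2 of an SL(2,R)-orbit, is
   represented by the SL(2,Z)-orbit consisting of the origamis it comes from. *)
Definition W_components : {set {set {set sqpair (d * n)}}} :=
  [set sl2z_orbit o | o in W_origamis]%SET.

Definition HLK_value (eps : bool) : nat * seq nat :=
  if odd d then (if eps then (1, [:: 3; 1; 1]) else (3, [:: 1; 1; 1]))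
  else (if eps then (2, [:: 2; 2; 0]) else (0, [:: 2; 2; 2])).

(* The components of W_{d^2}^eps[n], false and true standing for 0 and 1; meaningful
   for n odd. *)
Definition W_eps_components (eps : bool) : {set {set {set sqpair (d * n)}}} :=
  [set sl2z_orbit o | o in W_origamis
     & has_HLK o (HLK_value eps).1 (HLK_value eps).2]%SET.

End Loci.

Section Counts.
Variable m : nat.
Local Open Scope ring_scope.

Definition euler_P : rat := \prod_(p <- primes m) (1 - (p%:R ^+ 2)^-1).

Definition count_A : rat :=
  if odd m then 24%:R^-1 * m%:R ^+ 2 * (m%:R - 3%:R) * (m%:R - 5%:R) * euler_P
  else 24%:R^-1 * m%:R ^+ 3 * (m%:R - 2%:R) * euler_P.

Definition count_S : rat :=
  if odd m then 8%:R^-1 * m%:R ^+ 2 * (m%:R - 1) * (m%:R - 3%:R) * euler_P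
  else 8%:R^-1 * m%:R ^+ 2 * (m%:R - 2%:R) * (m%:R - 4%:R) * euler_P.

End Counts.

Definition primitive_H11_orbits (m : nat) : {set {set {set sqpair m}}} :=
  [set sl2z_orbit o | o in origamis m & in_H11 o && `[< primitive_origami o >]]%SET.

Definition Zmiaikou_conjecture : Prop :=
  forall m : nat, 7 <= m ->
    exists OA OS : {set {set sqpair m}},
      [/\ OA != OS, primitive_H11_orbits m = [set OA; OS]%SET,
          (forall o, iso_class o \in OA -> monodromy o = ('Alt_('I_m))%G) /\
            #|OA|%:R%R = count_A m
        & (forall o, iso_class o \in OS -> monodromy o = ('Sym_('I_m))%G) /\
            #|OS|%:R%R = count_S m].

Definition Parity_conjecture : Prop :=
  forall d n : nat, 2 <= d -> 1 <= n ->
    (d, n) \notin [:: (2, 1); (3, 1); (4, 1); (5, 1)] ->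
    (~~ odd n -> #|W_components d n| = 1) /\
    (odd n -> exists C0 C1 : {set {set sqpair (d * n)}},
       [/\ C0 != C1, W_components d n = [set C0; C1]%SET,
           W_eps_components d n false = [set C0]%SET
         & W_eps_components d n true = [set C1]%SET]).

(* Main.v *)
Require Import Defs.
From mathcomp Require Import all_boot all_order all_algebra.
From mathcomp Require Import all_fingroup all_solvable all_field.
From mathcomp Require Import boolp classical_sets functions cardinality.
From mathcomp Require Import zify ring lra.

(** Let Gam be the stabiliser in SL(2,Z) of an origami of W_{d^2}[n] with N = d n squares.
    The filled quotient H / Gam has large genus because Gam contains no hyperbolic element of
    small trace when d is large.

    Why there is none.  A hyperbolic element A of Gam is the derivative of an affine map f of
    the surface M.  On H^1(M; Q) the map f preserves the classes pulled back from the torus,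
    on which it acts through A, and the kernel K of the transfer to the torus, which has
    dimension 2 ([cocycle_dependence]).  So a vector y of K is annihilated by a polynomial q of
    degree at most 2.  By the lemma of Gauss q can be taken monic with integral coefficients
    ([integral_annihilator]).  Its roots are eigenvalues of the action of f on cochains, which
    is given by a non-negative matrix, so they are bounded in terms of the trace of A
    ([eigen_bound]).  Finally q is not the characteristic polynomial of A: the dilatation of f
    is a simple eigenvalue by Perron-Frobenius, with eigenvector pulled back from the torus
    ([perron_frobenius], [sub_cobound_of_quadratic_in]).  Now take an integral class c with
    transfer v and let y = N c - v.  Then N q(f) c = q(A) v, a non-zero class pulled back from
    the torus.  The left side has periods divisible by N, while the holonomies of loops form a
    subgroup of index n of Z^2; so N divides a non-zero integer bounded in terms of n and of
    the trace of A ([squares_bound]).  This fails for large d.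

    The matrix of f on cochains is non-negative when f is a composition of the moves T^-1
    and L^-1, with L the transpose of T.  Every element of SL(2,Z) is S^i w S^j with w a word
    in these two letters ([normal_form_act]), and a hyperbolic element of positive trace is
    conjugate to such a word ([cyclic_reduction]).  Both hold for the action on pairs of
    permutations, and not only for matrices.

    Why this is enough.  Let t be the number of cosets of the group generated by Gam and -1,
    and let v2, v3 and voo be the numbers of orbits of S, R and T on these cosets.  Then
    2 g - 2 = t - v2 - v3 - voo.  A coset fixed by S or R, or on a cusp of small width, has many
    translates by powers of T or of L that are not of the same kind, since otherwise two
    elements fixing the same coset would have a quotient that is hyperbolic of small trace
    ([card_fixed_elliptic], [card_short_cusps]).  Hence v2, v3 and voo exceed t / 2, t / 3 and 0
    by a small proportion of t only.  As t itself is large for the same reason ([many_cosets]),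
    so is g ([genus_large]). *)

Set Implicit Arguments.
Unset Strict Implicit.
Unset Printing Implicit Defensive.

Import Order.TTheory GRing.Theory Num.Theory.

(** * Two-by-two integer matrices *)

Section Mx2.
Local Open Scope ring_scope.

Lemma mx2E (A : 'M[int]_2) : A = mx2 (A 0 0) (A 0 1) (A 1 0) (A 1 1).
Proof.
by apply/matrixP=> i j; rewrite mxE; case: i => [] [|[|//]] ?;
  case: j => [] [|[|//]] ? /=; congr (A _ _); apply: val_inj.
Qed.

Lemma mul_mx2 a b c d a' b' c' d' :
  mx2 a b c d *m mx2 a' b' c' d' =
  mx2 (a * a' + b * c') (a * b' + b * d') (c * a' + d * c') (c * b' + d * d').
Proof.
apply/matrixP=> i j; rewrite !mxE big_ord_recl big_ord1 !mxE /=.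
by case: i => [] [|[|//]] ?; case: j => [] [|[|//]] ?.
Qed.

Lemma det_mx2 a b c d : \det (mx2 a b c d) = a * d - b * c.
Proof. by rewrite (expand_det_row _ 0) big_ord_recl big_ord1 /cofactor !det_mx11 !mxE /=; ring. Qed.

Lemma tr_mx2 a b c d : \tr (mx2 a b c d) = a + d.
Proof. by rewrite /mxtrace big_ord_recl big_ord1 !mxE. Qed.

Lemma one_mx2 : 1%:M = mx2 1 0 0 1.
Proof.
by apply/matrixP=> i j; rewrite !mxE; case: i => [] [|[|//]] ?; case: j => [] [|[|//]] ?.
Qed.

Lemma opp_mx2 a b c d : - mx2 a b c d = mx2 (- a) (- b) (- c) (- d).
Proof.
by apply/matrixP=> i j; rewrite !mxE; case: i => [] [|[|//]] ?; case: j => [] [|[|//]] ?.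
Qed.

Lemma invmx2 a b c d : a * d - b * c = 1 -> invmx (mx2 a b c d) = mx2 d (- b) (- c) a.
Proof.
move=> e; have u : mx2 a b c d \in unitmx by rewrite unitmxE det_mx2 e unitr1.
apply: (can_inj (mulKmx u)); rewrite mulmxV // mul_mx2 one_mx2.
by congr mx2; rewrite -?e; ring.
Qed.

Definition sl2 (A : 'M[int]_2) : Prop := \det A = 1.

Lemma sl2_unit A : sl2 A -> A \in unitmx.
Proof. by rewrite unitmxE => ->; rewrite unitr1. Qed.

Lemma sl2M A B : sl2 A -> sl2 B -> sl2 (A *m B).
Proof. by rewrite /sl2 det_mulmx => -> ->; rewrite mulr1. Qed.

Lemma sl2V A : sl2 A -> sl2 (invmx A).
Proof. by rewrite /sl2 det_inv => ->; rewrite invr1. Qed.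

Lemma sl2N A : sl2 A -> sl2 (- A).
Proof. by rewrite [A]mx2E opp_mx2 /sl2 !det_mx2 => <-; ring. Qed.

Lemma invmx_mul A B : sl2 A -> sl2 B -> invmx (A *m B) = invmx B *m invmx A.
Proof.
move=> sA sB; have u := sl2_unit (sl2M sA sB).
apply: (can_inj (mulKmx u)); rewrite mulmxV // -mulmxA mulKVmx ?mulmxV ?sl2_unit //.
Qed.

Lemma sl21 : sl2 1%:M.
Proof. by rewrite /sl2 det1. Qed.

Lemma sl2T : sl2 mxT. Proof. by rewrite /sl2 det_mx2. Qed.
Lemma sl2S : sl2 mxS. Proof. by rewrite /sl2 det_mx2. Qed.
Lemma sl2R : sl2 mxR. Proof. by rewrite /sl2 det_mx2. Qed.

Definition mxTk (k : int) : 'M[int]_2 := mx2 1 k 0 1.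
Definition mxLk (k : int) : 'M[int]_2 := mx2 1 0 k 1.

Lemma sl2Tk k : sl2 (mxTk k). Proof. by rewrite /sl2 det_mx2; ring. Qed.
Lemma sl2Lk k : sl2 (mxLk k). Proof. by rewrite /sl2 det_mx2; ring. Qed.

(** Euclid's algorithm on the first column brings any matrix to plus or minus a
    power of T. *)
Lemma sl2_ind (P : 'M[int]_2 -> Prop) :
  P 1%:M -> (forall A, sl2 A -> P A -> P (mxS *m A)) ->
  (forall A, sl2 A -> P A -> P (mxT *m A)) ->
  (forall A, sl2 A -> P A -> P (invmx mxT *m A)) ->
  forall A, sl2 A -> P A.
Proof.
move=> P1 PS PT PT'.
have PTn n A : sl2 A -> P A -> P (mxTk n%:Z *m A).
  move=> sA PA; elim: n => [|n IH].
    by rewrite /mxTk -one_mx2 mul1mx.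
  have -> : mxTk n.+1%:Z *m A = mxT *m (mxTk n%:Z *m A).
    by rewrite mulmxA /mxTk /mxT mul_mx2; congr (mx2 _ _ _ _ *m _); lia.
  by apply: PT => //; apply: sl2M => //; apply: sl2Tk.
have PTn' n A : sl2 A -> P A -> P (mxTk (- n%:Z) *m A).
  move=> sA PA; elim: n => [|n IH].
    by rewrite /mxTk oppr0 -one_mx2 mul1mx.
  have -> : mxTk (- n.+1%:Z) *m A = invmx mxT *m (mxTk (- n%:Z) *m A).
    rewrite mulmxA /mxTk /mxT invmx2 ?mul_mx2; last by ring.
    by congr (mx2 _ _ _ _ *m _); lia.
  by apply: PT' => //; apply: sl2M => //; apply: sl2Tk.
have PTk k A : sl2 A -> P A -> P (mxTk k *m A).
  by case: (intP k) => [|n|n]; [apply: (PTn 0) | apply: PTn | apply: PTn'].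
have PTV k A : sl2 A -> P (mxTk (- k) *m A) -> P A.
  move=> sA /(PTk k _ (sl2M (sl2Tk _) sA)); rewrite mulmxA /mxTk mul_mx2.
  by have -> : mx2 (1 * 1 + k * 0) (1 * - k + k * 1) (0 * 1 + 1 * 0) (0 * - k + 1 * 1)
     = 1%:M; [rewrite one_mx2; congr mx2; ring | rewrite mul1mx].
have PSV A : sl2 A -> P (mxS *m A) -> P A.
  move=> sA PA; have -> : A = mxS *m (mxS *m (mxS *m (mxS *m A))).
    rewrite !mulmxA -[LHS]mul1mx; congr (_ *m _).
    by rewrite /mxS !mul_mx2 one_mx2.
  have sS C : sl2 C -> sl2 (mxS *m C) by apply: sl2M; apply: sl2S.
  by apply: (PS _ (sS _ (sS _ (sS _ sA)))); apply: (PS _ (sS _ (sS _ sA)));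
    apply: (PS _ (sS _ sA)).
move=> A; have [m] := ubnP `|A 1%R 0%R|%N; elim: m A => // m IH A lem sA.
move: (lem) (sA); rewrite [A]mx2E; move: (A 0 0) (A 0 1) (A 1 0) (A 1 1) => a b c d.
rewrite {2}/mx2 mxE /= => lec sA'.
have [c0|cn0] := eqVneq c 0.
  have: a * d = 1 by move: sA'; rewrite /sl2 det_mx2 c0 mulr0 subr0.
  rewrite c0; move=> ad; have : (a = 1 /\ d = 1) \/ (a = -1 /\ d = -1).
    have/eqP := congr1 absz ad; rewrite abszM muln_eq1 => /andP[/eqP a1 /eqP d1].
    have [ea|ea] : a = 1 \/ a = -1 by lia.
      by left; subst a; lia.
    by right; subst a; lia.
  case=> [[-> ->]|[-> ->]].
    apply: (PTV b); first by rewrite /sl2 det_mx2; ring.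
    by rewrite /mxTk mul_mx2 (_ : mx2 _ _ _ _ = 1%:M) // one_mx2; congr mx2; ring.
  apply: (PSV); first by rewrite /sl2 det_mx2; ring.
  apply: (PSV); first by rewrite /mxS mul_mx2 /sl2 det_mx2; ring.
  apply: (PTV (- b)); first by rewrite /mxS !mul_mx2 /sl2 det_mx2; ring.
  by rewrite /mxTk /mxS !mul_mx2 (_ : mx2 _ _ _ _ = 1%:M) // one_mx2; congr mx2; ring.
apply: (PTV (a %/ c)%Z) => //; apply: (PSV); first exact: sl2M (sl2Tk _) _.
apply: IH; last by apply: sl2M; [exact: sl2S | exact: sl2M (sl2Tk _) _].
rewrite /mxTk /mxS !mul_mx2 mxE /=.
have := divz_eq a c; have := ltz_mod a cn0; have := modz_ge0 a cn0; lia.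
Qed.

End Mx2.

(** * Coset spaces of PSL(2,Z) and cells of the filled quotient surface *)

Section PermCounting.
Variable X : finType.
Implicit Types p : {perm X}.
Local Open Scope set_scope.

Lemma partition_porbits p : finset.partition (porbits p) [set: X].
Proof.
apply/and3P; split.
- apply/eqP/setP=> x; rewrite inE; apply/bigcupP.
  by exists (porbit p x); [apply: imset_f | apply: porbit_id].
- apply/finset.trivIsetP=> _ _ /imsetP[x _ ->] /imsetP[y _ ->] nxy.
  apply/pred0P=> z /=; apply/negP=> /andP[zx zy]; case/eqP: nxy.
  by move: zx zy; rewrite -!eq_porbit_mem => /eqP <- /eqP <-.
- by apply/imsetP=> -[x _ /setP/(_ x)]; rewrite porbit_id inE.
Qed.

(** Each orbit with at least [k] points uses up [k] points of [X], and each shorter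
    orbit is charged to one of its own points. *)
Lemma leq_porbits p k :
  (k * #|porbits p| <= #|X| + k * #|[set x | (#|porbit p x| < k)%N]|)%N.
Proof.
set E := [set x | _]; rewrite mulnC -sum_nat_const.
rewrite -[X in (_ <= X + _)%N]cardsT (card_partition (partition_porbits p)).
pose rep (C : {set X}) := [pick x in C].
have orbE C x : C \in porbits p -> x \in C -> C = porbit p x.
  by move=> /imsetP[y _ ->]; rewrite -eq_porbit_mem => /eqP.
have hE : (\sum_(C in porbits p) k * (#|C| < k) <= k * #|E|)%N.
  rewrite -big_distrr /= leq_mul2l; apply/orP; right.
  rewrite -big_mkcondr /= sum1_card.
  pose S := [set C in porbits p | (#|C| < k)%N].
  have -> : #|[pred C in porbits p | (#|C| < k)%N]| = #|S|.
    by apply: eq_card=> C; rewrite !inE.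
  have -> : S = [set porbit p x | x in E].
    apply/setP=> C; rewrite inE; apply/andP/imsetP.
      by case=> /imsetP[x _ ->] sz; exists x; rewrite ?inE.
    by case=> x; rewrite inE => sz ->; split=> //; apply: imset_f.
  exact: leq_imset_card.
apply: leq_trans (leq_add (leqnn _) hE); rewrite -big_split /=.
apply: leq_sum => C CP; case: ltnP => h; last by rewrite muln0 addn0.
by rewrite muln1 leq_addl.
Qed.

(** The translates of [E] by the inverses of the [q i] are pairwise disjoint. *)
Lemma card_disjoint_translates (E : {set X}) (M : nat) (q : nat -> {perm X}) :
  (forall i j x, (i < j < M)%N -> q i x \in E -> q j x \in E -> False) ->
  (M * #|E| <= #|X|)%N.
Proof.
move=> dis; pose F (u : 'I_M * X) := (q u.1)^-1%g u.2.
have injF : {in [set u : 'I_M * X | u.2 \in E] &, injective F}.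
  move=> [i x] [j y]; rewrite !inE /= => xE yE; rewrite /F /= => e.
  have [ij|ij|ij] := ltngtP (i : nat) (j : nat).
  - by case: (dis i j ((q i)^-1%g x)); rewrite ?ij ?ltn_ord ?permKV // e permKV.
  - by case: (dis j i ((q i)^-1%g x)); rewrite ?ij ?ltn_ord ?permKV // e permKV.
  - by have ij' := val_inj ij; subst j; rewrite (perm_inj e).
have -> : (M * #|E|)%N = #|[set u : 'I_M * X | u.2 \in E]|.
  rewrite -[in LHS](card_ord M) -(cardsT 'I_M) -finset.cardsX.
  by apply: eq_card => u; rewrite !inE.
by rewrite -(card_in_imset injF) max_card.
Qed.

End PermCounting.

Section CosetSurface.
Local Open Scope ring_scope.

(** [X] models the cosets of the group generated by [Gam] and -1. *)
Variables (Gam : set 'M[int]_2) (X : finType) (K : 'M[int]_2 -> X).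
Hypothesis Gam_sl2 : forall g, Gam g -> sl2 g.
Hypothesis K_surj : forall x, exists A, sl2 A /\ K A = x.
Hypothesis KP : forall A B, sl2 A -> sl2 B ->
  (K A = K B <-> exists g, Gam g /\ (B = g *m A \/ B = - (g *m A))).

Let rep x : {A | sl2 A /\ K A = x} := cid (K_surj x).

Lemma K_mulr A B g : sl2 A -> sl2 B -> sl2 g -> K A = K B -> K (A *m g) = K (B *m g).
Proof.
move=> sA sB sg /(KP sA sB)[c [cG e]]; apply/(KP (sl2M sA sg) (sl2M sB sg)).
by exists c; split=> //; case: e => ->; [left|right]; rewrite ?mulNmx mulmxA.
Qed.

Lemma K_opp A : sl2 A -> K (- A) = K A.
Proof.
move=> sA; have /(KP sA sA)[c [cG e]] : K A = K A by [].
have sA' := sl2N sA.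
symmetry; apply/(KP sA sA'); exists c; split=> //.
by case: e => e; [right; rewrite -e|left; rewrite {1}e opprK].
Qed.

Definition shift (g : 'M[int]_2) (x : X) : X := K (sval (rep x) *m g).

Lemma shiftK A g : sl2 A -> sl2 g -> shift g (K A) = K (A *m g).
Proof.
by move=> sA sg; rewrite /shift; case: (rep _) => B [sB e] /=; apply: K_mulr.
Qed.

Lemma shift_inj g : sl2 g -> injective (shift g).
Proof.
move=> sg x y; have [[A [sA <-]] [B [sB <-]]] := (K_surj x, K_surj y).
rewrite !shiftK // => /(K_mulr (sl2M sA sg) (sl2M sB sg) (sl2V sg)).
by rewrite -!mulmxA mulmxV ?sl2_unit // !mulmx1.
Qed.

Definition pshift g (sg : sl2 g) : {perm X} := perm (shift_inj sg).

Lemma pshiftK A g (sg : sl2 g) : sl2 A -> pshift sg (K A) = K (A *m g).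
Proof. by move=> sA; rewrite permE shiftK. Qed.

Lemma pshiftM g h (sg : sl2 g) (sh : sl2 h) (sgh : sl2 (g *m h)) :
  pshift sgh = (pshift sg * pshift sh)%g.
Proof.
apply/permP=> x; have [A [sA <-]] := K_surj x.
by rewrite permM !pshiftK ?mulmxA //; apply: sl2M.
Qed.

Lemma pshift_eq g h (sg : sl2 g) (sh : sl2 h) : g = h -> pshift sg = pshift sh.
Proof. by move=> e; apply/permP=> x; rewrite !permE e. Qed.

Lemma pshift1 (s1 : sl2 1%:M) : pshift s1 = 1%g.
Proof.
by apply/permP=> x; have [A [sA <-]] := K_surj x; rewrite pshiftK // mulmx1 perm1.
Qed.

Lemma sl2X g (n : nat) : sl2 g -> sl2 (g ^+ n).
Proof.
move=> sg; elim: n => [|n IH]; first by rewrite expr0; apply: sl21.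
by rewrite exprS; apply: sl2M.
Qed.

Lemma pshiftX A g (sg : sl2 g) n : sl2 A -> (pshift sg ^+ n)%g (K A) = K (A *m g ^+ n).
Proof.
move=> sA; elim: n => [|n IH]; first by rewrite expg0 perm1 expr0 mulmx1.
rewrite expgSr permM IH pshiftK; last by apply: sl2M => //; apply: sl2X.
by rewrite exprSr mulmxA.
Qed.

Definition coset_union (C : {set X}) : set 'M[int]_2 := [set B | sl2 B /\ K B \in C]%classic.

(** The double coset of [A] is the union of the cosets met by the orbit of [K A]
    under right multiplication by [g], because [K] does not see signs. *)
Lemma double_cosetE A g (sg : sl2 g) : sl2 A ->
  [set (c *m A *m k)%R | c in Gam & k in pm_powers g]%classic =
  coset_union (porbit (pshift sg) (K A)).
Proof.
move=> sA; apply/seteqP; split=> [B|B].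
  have K1 c (D : 'M_2) : Gam c -> sl2 D -> K (c *m D) = K D.
    move=> cG sD; have sc := Gam_sl2 cG; symmetry; apply/(KP sD (sl2M sc sD)).
    by exists c; split=> //; left.
  case=> c cG [k [j ke] <-].
  have [m Km] : sl2 (g ^ j) /\ K (A *m g ^ j) \in porbit (pshift sg) (K A).
    case: (intP j) => [|n|n].
    - by rewrite expr0z mulmx1 porbit_id; split=> //; apply: sl21.
    - split; first exact: sl2X.
      by rewrite -exprnP -pshiftX // mem_porbit.
    - have sgn := sl2X n.+1 sg.
      have -> : g ^ (- n.+1%:Z) = invmx (g ^+ n.+1) by rewrite -exprnN.
      split; first exact: sl2V.
      rewrite porbit_sym; apply/porbitP; exists n.+1; rewrite pshiftX.
        by rewrite -mulmxA mulVmx ?mulmx1 // sl2_unit.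
      by apply: sl2M => //; apply: sl2V.
  have sAg := sl2M sA m; rewrite /coset_union /=.
  have sc := Gam_sl2 cG.
  have sAc := sl2M sc sAg; have KAc := K1 c _ cG sAg.
  case: ke => ->; rewrite ?mulmxN -mulmxA; first by split; rewrite ?KAc.
  by split; [exact: sl2N | rewrite K_opp // KAc].
case=> sB /porbitP[n]; rewrite pshiftX // => /esym.
have sgn := sl2X n sg; have sAg := sl2M sA sgn.
move=> /(KP sAg sB)[c [cG e]]; exists c => //.
case: e => ->; [exists (g ^+ n)|exists (- g ^+ n)].
- by exists n%:Z; left.
- by rewrite mulmxA.
- by exists n%:Z; right.
- by rewrite mulmxN mulmxA.
Qed.

Lemma card_double_cosets g (sg : sl2 g) :
  (double_cosets Gam (pm_powers g) #= `I_#|porbits (pshift sg)|)%card.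
Proof.
pose f (i : 'I_#|porbits (pshift sg)|) := coset_union (enum_val i).
have injf : injective f.
  move=> i j /seteqP[] s1 s2; apply: enum_val_inj; apply/setP=> x.
  have [A [sA <-]] := K_surj x.
  by apply/idP/idP => h; [have [] := s1 A (conj sA h)|have [] := s2 A (conj sA h)].
have -> : double_cosets Gam (pm_powers g) = (f @` [set: 'I_#|porbits (pshift sg)|])%classic.
  apply/seteqP; split=> [_ [A sA <-]|_ [i _ <-]].
    have xP : porbit (pshift sg) (K A) \in porbits (pshift sg) by apply: imset_f.
    by exists (enum_rank_in xP (porbit (pshift sg) (K A))) => //;
      rewrite /f enum_rankK_in // (double_cosetE sg sA).
  have /imsetP[x _ e] := enum_valP i; have [A [sA eA]] := K_surj x.
  by exists A => //; rewrite /f e -eA -(double_cosetE sg sA).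
apply: card_eq_trans (inj_card_eq _) _; first by move=> i j _ _; apply: injf.
by rewrite card_eq_sym card_II.
Qed.

End CosetSurface.

(** * Genus of a quotient without short hyperbolic elements *)

Section GenusBound.
Local Open Scope ring_scope.

Variables (Gam : set 'M[int]_2) (X : finType) (K : 'M[int]_2 -> X).
Hypothesis Gam_sl2 : forall g, Gam g -> sl2 g.
Hypothesis K_surj : forall x, exists A, sl2 A /\ K A = x.
Hypothesis KP : forall A B, sl2 A -> sl2 B ->
  (K A = K B <-> exists g, Gam g /\ (B = g *m A \/ B = - (g *m A))).
Variable tau : int.
Hypothesis Gam_tr : forall g, Gam g -> 2 < \tr g <= tau -> False.
Hypothesis Gam_trN : forall g, Gam g -> 2 < - \tr g <= tau -> False.

Notation ps := (pshift K_surj KP).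

(** Conjugation by [A] carries the elements fixing [K A] into [Gam] up to sign, hence
    also the quotient of two of them; its trace is then one that [Gam] excludes. *)
Lemma fixed_pair_tr A u v : sl2 A -> sl2 u -> sl2 v ->
  K (A *m u) = K A -> K (A *m v) = K A -> 2 < \tr (u *m invmx v) <= tau -> False.
Proof.
move=> sA su sv eu ev htr.
have sv' := sl2V sv; have sAu := sl2M sA su; have sAv := sl2M sA sv.
have e : K A = K (A *m u *m invmx v).
  rewrite (K_mulr KP sAu sAv sv') ?eu ?ev //.
  by rewrite -mulmxA mulmxV ?mulmx1 // sl2_unit.
move/(KP sA (sl2M sAu sv')): e => [c [cG e]].
have uA := sl2_unit sA.
case: e => e.
  apply: (Gam_tr cG); rewrite (_ : \tr c = \tr (u *m invmx v)) //.
  have -> : c = A *m (u *m invmx v) *m invmx A by rewrite mulmxA e mulmxK.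
  by rewrite mxtrace_mulC mulKmx.
apply: (Gam_trN cG); rewrite (_ : - \tr c = \tr (u *m invmx v)) //.
have -> : c = - (A *m (u *m invmx v) *m invmx A) by rewrite mulmxA e mulNmx mulmxK ?opprK.
by rewrite raddfN /= mxtrace_mulC mulKmx // opprK.
Qed.

Lemma pshift_fix_conj g (sg : sl2 g) h (sh : sl2 h) A : sl2 A ->
  ps sg (ps sh (K A)) = ps sh (K A) -> K (A *m (h *m g *m invmx h)) = K A.
Proof.
move=> sA; have sAh := sl2M sA sh; rewrite !pshiftK // => e.
have := K_mulr KP (sl2M sAh sg) sAh (sl2V sh) e.
by rewrite -!mulmxA mulmxV ?mulmx1 ?sl2_unit // => ->.
Qed.

Lemma porbit_fix g (sg : sl2 g) A : sl2 A ->
  K (A *m g ^+ #|porbit (ps sg) (K A)|) = K A.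
Proof. by move=> sA; rewrite -(pshiftX K_surj KP) // permX iter_porbit. Qed.

Lemma mxTkX k n : mxTk k ^+ n = mxTk (k * n%:Z).
Proof.
elim: n => [|n IH]; first by rewrite mulr0 expr0 /mxTk -one_mx2.
by rewrite exprS IH /mxTk -mulmxE mul_mx2; congr mx2; lia.
Qed.

Lemma mxLkX k n : mxLk k ^+ n = mxLk (k * n%:Z).
Proof.
elim: n => [|n IH]; first by rewrite mulr0 expr0 /mxLk -one_mx2.
by rewrite exprS IH /mxLk -mulmxE mul_mx2; congr mx2; lia.
Qed.

(** If [g] fixes both x T^i and x T^j, then x is fixed by T^i g T^-i and T^j g T^-j.
    As the lower left entry of [g] is 1, their quotient has trace 2 + (j - i)^2, so the
    translates by powers of T of the fixed points of [g] are disjoint. *)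
Lemma card_fixed_elliptic (M : nat) a b d (sg : sl2 (mx2 a b 1 d)) :
  2 + M%:Z ^+ 2 <= tau -> (M * #|[set x | ps sg x == x]%SET| <= #|X|)%N.
Proof.
move=> hM; pose q (i : nat) := ps (sl2Tk i%:Z).
apply: (@card_disjoint_translates _ _ M q) => i j x /andP[ij jM].
have [A [sA <-]] := K_surj x; rewrite !inE => /eqP ei /eqP ej.
have {}ei := pshift_fix_conj sA ei; have {}ej := pshift_fix_conj sA ej.
have sc k : sl2 (mxTk k *m mx2 a b 1 d *m invmx (mxTk k)).
  exact: sl2M (sl2M (sl2Tk _) sg) (sl2V (sl2Tk _)).
apply: (fixed_pair_tr sA (sc _) (sc _) ei ej).
move: sg; rewrite /sl2 det_mx2 => sg.
have e k : mxTk k *m mx2 a b 1 d *m invmx (mxTk k)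
   = mx2 (a + k) (b + k * d - k * a - k * k) 1 (d - k).
  by rewrite /mxTk invmx2 ?mul_mx2; [congr mx2; ring | ring].
have b1 : b = a * d - 1 by rewrite -[X in _ - X]sg; ring.
rewrite !e invmx2; last by rewrite b1; ring.
rewrite mul_mx2 tr_mx2.
set t := (X in _ < X <= _); have -> : t = 2 + (j%:Z - i%:Z) ^+ 2.
  by rewrite /t b1; ring.
have := jM; have := ij; move: hM; nia.
Qed.

(** With L the transpose of T, two cusps of widths m and n at x L^i and x L^j give
    two parabolic elements fixing x whose quotient has trace 2 + m n (j - i)^2.  So
    short cusps move off themselves under powers of L. *)
Lemma card_short_cusps (M : nat) (sT : sl2 mxT) :
  2 + M%:Z ^+ 4 <= tau ->
  (M * #|[set x | (#|porbit (ps sT) x| < M)%N]%SET| <= #|X|)%N.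
Proof.
move=> hM; pose q (i : nat) := ps (sl2Lk i%:Z).
apply: (@card_disjoint_translates _ _ M q) => i j x /andP[ij jM].
have [A [sA <-]] := K_surj x; rewrite !inE /q !pshiftK // => ei ej.
have sAk k := sl2M sA (sl2Lk k).
have conjE k : K (A *m (mxLk k *m mxT ^+ #|porbit (ps sT) (K (A *m mxLk k))| *m invmx (mxLk k)))
   = K A.
  have := porbit_fix sT (sAk k); set n := #|_| => e.
  have := K_mulr KP (sl2M (sAk k) (sl2X n sT)) (sAk k) (sl2V (sl2Lk k)) e.
  by rewrite -!mulmxA (mulmxV (sl2_unit (sl2Lk k))) mulmx1.
have gt0 y : (0 < #|porbit (ps sT) y|)%N by rewrite lt0n card_porbit_neq0.
have := conjE i%:Z; have := conjE j%:Z; move: (gt0 (K (A *m mxLk i%:Z))) (gt0 (K (A *m mxLk j%:Z))) ei ej.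
move: #|_| #|_| => m n m0 n0 mM nM ej ei.
have sc (k : int) (l : nat) : sl2 (mxLk k *m mxT ^+ l *m invmx (mxLk k)).
  exact: sl2M (sl2M (sl2Lk _) (sl2X _ sl2T)) (sl2V (sl2Lk _)).
apply: (fixed_pair_tr sA (sc _ _) (sc _ _) ei ej).
have e (k : int) (l : nat) : mxLk k *m mxT ^+ l *m invmx (mxLk k)
   = mx2 (1 - k * l%:Z) l%:Z (- (k * k * l%:Z)) (1 + k * l%:Z).
  rewrite [mxT](_ : _ = mxTk 1) // mxTkX.
  by rewrite /mxTk /mxLk invmx2 ?mul_mx2; [congr mx2; ring | ring].
rewrite !e invmx2 ?mul_mx2 ?tr_mx2; last by ring.
set t := (X in _ < X <= _); have -> : t = 2 + m%:Z * n%:Z * (j%:Z - i%:Z) ^+ 2.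
  by rewrite /t; ring.
have mn0 : 0 < m%:Z * n%:Z by rewrite mulr_gt0 // ltz_nat.
have k0 : 0 < (j%:Z - i%:Z) ^+ 2 by rewrite exprn_gt0 // subr_gt0 ltz_nat.
rewrite ltrDl mulr_gt0 //= (le_trans _ hM) // lerD2l.
rewrite (_ : M%:Z ^+ 4 = (M%:Z * M%:Z) * M%:Z ^+ 2); last by ring.
apply: ler_pM; rewrite ?(ltW mn0) ?(ltW k0) //; first by apply: ler_pM => //; lia.
by rewrite ler_pXn2r ?nnegrE //; lia.
Qed.

(** If m and n are the widths of the cusps oo and 0, then T^m L^n is in [Gam] up to
    sign and has trace 2 + m n, while m and n are at most the number of cosets. *)
Lemma many_cosets (k : nat) : 2 + k%:Z ^+ 2 <= tau -> (k < #|X|)%N.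
Proof.
move=> hk; rewrite ltnNge; apply/negP=> tk.
pose sL := sl2Lk (-1).
have := porbit_fix sL sl21; have := porbit_fix sl2T sl21.
have : (0 < #|porbit (ps sl2T) (K 1%:M)| <= #|X|)%N by rewrite lt0n card_porbit_neq0 max_card.
have : (0 < #|porbit (ps sL) (K 1%:M)| <= #|X|)%N by rewrite lt0n card_porbit_neq0 max_card.
move: #|porbit _ _| #|porbit _ _| => m n /andP[m0 mk] /andP[n0 nk] en em.
apply: (fixed_pair_tr sl21 (sl2X m sl2T) (sl2X n sL) en em).
rewrite [mxT](_ : _ = mxTk 1) // mxTkX mxLkX /mxTk /mxLk invmx2; last by ring.
rewrite mul_mx2 tr_mx2.
set t := (X in _ < X <= _); have -> : t = 2 + m%:Z * n%:Z by rewrite /t; ring.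
rewrite ltrDl mulr_gt0 ?ltz_nat //= (le_trans _ hk) // lerD2l expr2.
by apply: ler_pM => //; rewrite lez_nat; apply: leq_trans tk.
Qed.

(** With t cosets, 2 g - 2 = t - v2 - v3 - voo.  Up to an error of t / 48 for each kind
    of exceptional point, v2 is at most t / 2, v3 at most t / 3 and voo at most t / 48,
    so that 2 g - 2 is at least t / 12.  The Euler characteristic is even because
    R = T S: the signs of the permutations of the cosets by R, S and T multiply up. *)
Lemma genus_large (G : nat) :
  2 + (24 * (G + 1)%:Z) ^+ 2 <= tau -> 2 + 48 ^+ 4 <= tau ->
  exists g : nat, has_genus Gam g /\ (G <= g)%N.
Proof.
move=> hG h48; pose M := 48%N.
have hM : 2 + M%:Z ^+ 4 <= tau by [].
have hM2 : 2 + M%:Z ^+ 2 <= tau.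
  apply: le_trans hM; rewrite lerD2l; apply: ler_weXn2l => //.
have t_big : (24 * (G + 1) < #|X|)%N by apply: many_cosets; rewrite PoszM.
have eS := leq_porbits (ps sl2S) 2.
have eR := leq_porbits (ps sl2R) 3.
have eT := leq_porbits (ps sl2T) M.
have cT := card_short_cusps sl2T hM.
have cS : (M * #|[set x | (#|porbit (ps sl2S) x| < 2)%N]%SET| <= #|X|)%N.
  apply: leq_trans (card_fixed_elliptic sl2S hM2); rewrite leq_mul2l subset_leq_card ?orbT //.
  apply/fintype.subsetP=> x; rewrite !inE => lt2.
  have o1 : #|porbit (ps sl2S) x| = 1%N.
    by apply/eqP; rewrite eqn_leq -ltnS lt2 lt0n card_porbit_neq0.
  by have := iter_porbit (ps sl2S) x; rewrite o1 => /= ->.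
have cR : (M * #|[set x | (#|porbit (ps sl2R) x| < 3)%N]%SET| <= #|X|)%N.
  apply: leq_trans (card_fixed_elliptic sl2R hM2); rewrite leq_mul2l subset_leq_card ?orbT //.
  apply/fintype.subsetP=> x; rewrite !inE => lt3.
  have R3 : ps sl2R (ps sl2R (ps sl2R x)) = x.
    have [A [sA <-]] := K_surj x.
    have := pshiftX K_surj KP sl2R 3 sA; rewrite permX /= => ->.
    have -> : A *m mxR ^+ 3 = - A.
      rewrite (_ : mxR ^+ 3 = - 1%:M) ?mulmxN ?mulmx1 //.
      by rewrite !exprS expr0 mulr1 -!mulmxE /mxR !mul_mx2 one_mx2 opp_mx2.
    by rewrite (K_opp KP).
  have := iter_porbit (ps sl2R) x; have := card_porbit_neq0 (ps sl2R) x.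
  move: #|_| lt3 => [|[|[|]]] //= _ _; first by move=> ->.
  by move=> e; rewrite -{2}R3 e.
have par : ~~ odd (#|X| + #|porbits (ps sl2S)| + #|porbits (ps sl2R)| + #|porbits (ps sl2T)|).
  have eTS : sl2 (mxT *m mxS) by apply: sl2M; [exact: sl2T | exact: sl2S].
  have RTS : ps sl2R = (ps sl2T * ps sl2S)%g.
    rewrite -(pshiftM K_surj KP _ _ eTS); apply: pshift_eq.
    by rewrite /mxT /mxS mul_mx2.
  have := congr1 (fun s => odd_perm s) RTS; rewrite /= odd_permM /odd_perm.
  by rewrite !oddD; do 4 case: (odd _).
have c1 := card_double_cosets Gam_sl2 K_surj KP (sl21 : sl2 1).
have p1 : #|porbits (ps (sl21 : sl2 1))| = #|X|.
  rewrite (pshift1 K_surj KP).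
  rewrite /porbits card_imset //.
  move=> x y /setP/(_ x); rewrite porbit_id => /esym/porbitP[i ->].
  by rewrite expg1n perm1.
rewrite p1 in c1.
move: eS eR eT cS cR cT t_big par c1.
have cdS := card_double_cosets Gam_sl2 K_surj KP sl2S.
have cdR := card_double_cosets Gam_sl2 K_surj KP sl2R.
have cdT := card_double_cosets Gam_sl2 K_surj KP sl2T.
move: (#|porbits (ps sl2S)|) (#|porbits (ps sl2R)|) (#|porbits (ps sl2T)|) cdS cdR cdT => v2 v3 voo cdS cdR cdT.
rewrite /M; set a := #|[set x | _]%SET|; set b := #|[set x | _]%SET|; set c := #|[set x | _]%SET|.
move: a b c #|X| => a b c t eS eR eT cS cR cT t_big par c1.
exists ((t + 2 - v2 - v3 - voo)./2)%N; split; last by lia.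
by exists v2, v3, voo, t; split=> //; lia.
Qed.

End GenusBound.

(** * Moves on pairs of permutations *)

Section Moves.
Variable N : nat.
Local Open Scope group_scope.
Implicit Types (o : sqpair N) (s : {perm 'I_N}).

Definition iso o o' : Prop := exists s, o' = conj_pair o s.

Lemma conj_pairM o s s' : conj_pair (conj_pair o s) s' = conj_pair o (s * s').
Proof. by rewrite /conj_pair /= !conjgM. Qed.

Lemma conj_pair1 o : conj_pair o 1 = o.
Proof. by rewrite /conj_pair !conjg1 -surjective_pairing. Qed.

Lemma iso_refl o : iso o o.
Proof. by exists 1; rewrite conj_pair1. Qed.

Lemma iso_sym o o' : iso o o' -> iso o' o.
Proof. by case=> s ->; exists s^-1; rewrite conj_pairM mulgV conj_pair1. Qed.

Lemma iso_trans o1 o2 o3 : iso o1 o2 -> iso o2 o3 -> iso o1 o3.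
Proof. by case=> s -> [s' ->]; exists (s * s'); rewrite conj_pairM. Qed.

Definition moveS o : sqpair N := (o.2^-1, o.1).
Definition moveT o : sqpair N := (o.1, o.2 * o.1^-1).
(** The actions of T^-1 and L^-1, where L is the transpose of T.  Unlike [moveT], these
    moves compose paths without backtracking, which makes their effect on cochains
    non-negative. *)
Definition moveTV o : sqpair N := (o.1, o.2 * o.1).
Definition moveLV o : sqpair N := (o.2 * o.1, o.2).

Lemma moveS_conj o s : moveS (conj_pair o s) = conj_pair (moveS o) s.
Proof. by rewrite /moveS /conj_pair /= conjVg. Qed.
Lemma moveT_conj o s : moveT (conj_pair o s) = conj_pair (moveT o) s.
Proof. by rewrite /moveT /conj_pair /= conjMg conjVg. Qed.
Lemma moveTV_conj o s : moveTV (conj_pair o s) = conj_pair (moveTV o) s.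
Proof. by rewrite /moveTV /conj_pair /= conjMg. Qed.
Lemma moveLV_conj o s : moveLV (conj_pair o s) = conj_pair (moveLV o) s.
Proof. by rewrite /moveLV /conj_pair /= conjMg. Qed.

Lemma iso_moveS o o' : iso o o' -> iso (moveS o) (moveS o').
Proof. by case=> s ->; exists s; rewrite moveS_conj. Qed.
Lemma iso_moveT o o' : iso o o' -> iso (moveT o) (moveT o').
Proof. by case=> s ->; exists s; rewrite moveT_conj. Qed.

Lemma iso_iterS n o o' : iso o o' -> iso (iter n moveS o) (iter n moveS o').
Proof. by move=> h; elim: n => //= n; apply: iso_moveS. Qed.

Definition letter (x : bool) o := if x then moveTV o else moveLV o.
Definition word (w : seq bool) o := foldr letter o w.

Lemma iso_letter x o o' : iso o o' -> iso (letter x o) (letter x o').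
Proof.
by case=> s ->; exists s; case: x; rewrite /= ?moveTV_conj ?moveLV_conj.
Qed.

Lemma moveS4 o : iter 4 moveS o = o.
Proof. by rewrite /= /moveS /= !invgK -surjective_pairing. Qed.

Lemma moveS4X k o : iter (k * 4) moveS o = o.
Proof. by elim: k => // k IH; rewrite mulSn iterD IH moveS4. Qed.

Lemma moveTK o : moveT (moveTV o) = o.
Proof. by rewrite /moveT /moveTV /= mulgK -surjective_pairing. Qed.
Lemma moveTVK o : moveTV (moveT o) = o.
Proof. by rewrite /moveT /moveTV /= mulgKV -surjective_pairing. Qed.

Definition normg (gT : finGroupType) :=
  (@invMg gT, @invgK gT, @mulgA gT, @mulgK gT, @mulgKV gT, @mulVg gT, @mulgV gT,
   @mul1g gT, @mulg1 gT).

Ltac witness s :=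
  exists s; rewrite /conj_pair /moveS /moveT /moveTV /moveLV /conjg /=;
  congr (_, _); rewrite ?normg //.

(** The relations of SL(2,Z) hold for the moves only up to simultaneous conjugation. *)
Lemma moveT_S2 o : iso (moveT (moveS (moveS o))) (moveS (moveS (moveT o))).
Proof. by witness (o.1^-1). Qed.

Lemma letter_S2 x o : iso (letter x (moveS (moveS o))) (moveS (moveS (letter x o))).
Proof. by case: x; [witness (o.1)|witness (o.2^-1)]. Qed.

Lemma moveT_S o : iso (moveT (moveS o)) (moveS (moveLV o)).
Proof. by witness (o.2^-1). Qed.

Lemma moveT_L o : iso (moveT (moveLV o)) (iter 3 moveS (moveTV o)).
Proof. by witness (o.2 * o.1). Qed.

Lemma moveT_1 o : iso (moveT o) (moveS (moveLV (iter 3 moveS o))).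
Proof. by witness (o.1). Qed.

(** Two equal letters around S collapse to the other letter, two different ones to S. *)
Lemma tSt o : moveTV (moveS (moveTV o)) = moveS (moveS (moveLV o)).
Proof. by rewrite /moveTV /moveS /moveLV /= !normg. Qed.
Lemma lSl o : iso (moveLV (moveS (moveLV o))) (moveTV o).
Proof. by witness (o.2 * o.1). Qed.
Lemma tSl o : iso (moveTV (moveS (moveLV o))) (moveS o).
Proof. by witness (o.2). Qed.
Lemma lSt o : moveLV (moveS (moveTV o)) = moveS o.
Proof. by rewrite /moveLV /moveS /moveTV /= !normg. Qed.

Lemma moveTV_word o :
  iso (moveS (moveT (moveS (moveT (iter 3 moveS o))))) (moveTV o).
Proof. by witness (o.2 * o.1). Qed.

End Moves.

(** * Words for the action of SL(2,Z) *)

Section Action.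
Local Open Scope ring_scope.
Variable N : nat.
Implicit Types (o : sqpair N) (A B : 'M[int]_2).

Definition mat_letter (x : bool) : 'M[int]_2 := if x then mxTk (-1) else mxLk (-1).
Definition mat_word (w : seq bool) : 'M[int]_2 :=
  foldr (fun x A => mat_letter x *m A) 1%:M w.

Lemma mxS2 : mxS *m mxS = - 1%:M.
Proof. by rewrite /mxS mul_mx2 one_mx2 opp_mx2. Qed.

Lemma mxSX_even n : mxS ^+ n.*2 = (-1) ^+ n.
Proof. by rewrite -muln2 mulnC exprM expr2 -mulmxE mxS2. Qed.

Lemma invmxT : invmx mxT = mxTk (-1).
Proof. by rewrite /mxT invmx2. Qed.

Lemma sl2z_act_sl2 A o o' : sl2z_act A o o' -> sl2 A.
Proof.
elim=> {A o o'} [o s|o|o|A B o o' o'' _ sB _ sA]; first exact: sl21.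
- exact: sl2T.
- exact: sl2S.
- exact: sl2M.
Qed.

Lemma sl2z_act_isor A o o' o'' : sl2z_act A o o' -> iso o' o'' -> sl2z_act A o o''.
Proof. by move=> a [s ->]; rewrite -[A]mul1mx; apply: sl2z_act_mul a (sl2z_act_iso _ _). Qed.

Lemma sl2z_act_refl o : sl2z_act 1%:M o o.
Proof. by have := sl2z_act_iso o 1%g; rewrite conj_pair1. Qed.

Lemma sl2z_act_moveS o : sl2z_act mxS o (moveS o).
Proof. exact: sl2z_act_S. Qed.

Lemma sl2z_act_moveT o : sl2z_act mxT o (moveT o).
Proof. exact: sl2z_act_T. Qed.

Lemma sl2z_act_iterS n o : sl2z_act (mxS ^+ n) o (iter n (@moveS N) o).
Proof.
elim: n => [|n IH]; first by rewrite expr0; apply: sl2z_act_refl.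
by rewrite exprS iterS; apply: sl2z_act_mul IH (sl2z_act_moveS _).
Qed.

Lemma sl2z_act_moveTV o : sl2z_act (mxTk (-1)) o (moveTV o).
Proof.
apply: sl2z_act_isor (moveTV_word o).
have -> : mxTk (-1) = mxS *m (mxT *m (mxS *m (mxT *m mxS ^+ 3))).
  by rewrite !exprS expr0 mulr1 -!mulmxE /mxS /mxT /mxTk !mul_mx2.
apply: sl2z_act_mul (sl2z_act_moveS _).
apply: sl2z_act_mul (sl2z_act_moveT _).
apply: sl2z_act_mul (sl2z_act_moveS _).
by apply: sl2z_act_mul (sl2z_act_moveT _); apply: sl2z_act_iterS.
Qed.

Lemma sl2z_act_letter x o : sl2z_act (mat_letter x) o (letter x o).
Proof.
case: x; first exact: sl2z_act_moveTV.
have -> : letter false o = moveS (moveT (iter 3 (@moveS N) o)).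
  by rewrite /= /moveS /moveT /moveLV /= !normg.
have -> : mat_letter false = mxS *m (mxT *m mxS ^+ 3).
  by rewrite !exprS expr0 mulr1 -!mulmxE /mxS /mxT /mat_letter /mxLk !mul_mx2.
apply: sl2z_act_mul (sl2z_act_moveS _).
by apply: sl2z_act_mul (sl2z_act_moveT _); apply: sl2z_act_iterS.
Qed.

Lemma sl2z_act_inv A o o' : sl2z_act A o o' -> sl2z_act (invmx A) o' o.
Proof.
elim=> {A o o'} [o s|o|o|A B o o' o'' aB iB aA iA].
- have [s' e] := iso_sym (ex_intro _ s erefl : iso o (conj_pair o s)).
  by rewrite invmx1 {2}e; apply: sl2z_act_iso.
- have := sl2z_act_moveTV (moveT o); rewrite moveTVK -invmxT; exact.
- have -> : invmx mxS = mxS ^+ 3.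
    by rewrite !exprS expr0 mulr1 -!mulmxE /mxS invmx2 // !mul_mx2.
  by have := sl2z_act_iterS 3 (moveS o); rewrite -iterSr moveS4.
- rewrite (invmx_mul (sl2z_act_sl2 aA) (sl2z_act_sl2 aB)).
  exact: sl2z_act_mul iA iB.
Qed.

Lemma sl2z_act_total A o : sl2 A -> exists o', sl2z_act A o o'.
Proof.
move=> sA; elim/sl2_ind: A / sA.
- by exists o; apply: sl2z_act_refl.
- by move=> A _ [o' a]; exists (moveS o'); apply: sl2z_act_mul a (sl2z_act_moveS _).
- by move=> A _ [o' a]; exists (moveT o'); apply: sl2z_act_mul a (sl2z_act_moveT _).
- move=> A _ [o' a]; exists (moveTV o'); rewrite invmxT.
  exact: sl2z_act_mul a (sl2z_act_moveTV _).
Qed.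

(** Every element of the group takes this shape, which isolates a positive word. *)
Definition normal_form A o o' : Prop := exists i w j,
  A = mxS ^+ i *m mat_word w *m mxS ^+ j /\
  iso (iter i (@moveS N) (word w (iter j (@moveS N) o))) o'.

Lemma normal_form_S A o o' : normal_form A o o' -> normal_form (mxS *m A) o (moveS o').
Proof.
case=> i [w [j [-> h]]]; exists i.+1, w, j; split; last exact: iso_moveS.
by rewrite exprS -!mulmxA.
Qed.

Lemma normal_form_isor A o o' o'' : normal_form A o o' -> iso o' o'' -> normal_form A o o''.
Proof.
by case=> i [w [j [e h]]] h'; exists i, w, j; split=> //; apply: iso_trans h h'.
Qed.

(** T cancels a leading T^-1, it turns a leading L^-1 into S^-1 T^-1, and it passes
    through S as L^-1, since S^-1 T S = L^-1. *)
Lemma normal_form_T A o o' : normal_form A o o' -> normal_form (mxT *m A) o (moveT o').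
Proof.
case=> i [w [j [-> h]]]; apply: normal_form_isor (iso_moveT h) => {o' h}.
have [k] := ubnP i; elim: k i w => // k IH i w lek.
case: i lek => [|[|i]] lek.
- case: w => [|x w].
    exists 1%N, [:: false], (3 + j)%N; split.
      rewrite exprD -mulmxE !mulmxA /= expr0 expr1 !mulmx1; congr (_ *m _).
      by rewrite /mxS /mxT /mxLk !mul_mx2.
    by rewrite iterD; apply: iso_sym; apply: moveT_1.
  case: x.
    exists 0, w, j; split; last by rewrite /= moveTK; apply: iso_refl.
    rewrite !expr0 !mul1mx /= !mulmxA.
    by rewrite [mxT *m _](_ : _ = 1%:M) ?mul1mx // /mxT /mxTk mul_mx2 one_mx2.
  exists 3%N, (true :: w), j; split; last by apply: iso_sym; apply: moveT_L.
  rewrite expr0 mul1mx /= !mulmxA; congr (_ *m _ *m _).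
  by rewrite !exprS expr0 mulr1 -!mulmxE /mxS /mxT /mxLk /mxTk !mul_mx2.
- exists 1%N, (false :: w), j; split; last by apply: iso_sym; apply: moveT_S.
  rewrite expr1 /= !mulmxA; congr (_ *m _ *m _).
  by rewrite /mxS /mxT /mxLk !mul_mx2.
- have /(IH _ w) := ltnW (ltnSE lek); case=> i' [w' [j' [e h]]].
  exists i'.+2, w', j'; split.
    have S2 n : mxS ^+ n.+2 = - mxS ^+ n.
      by rewrite !exprS mulrA -!mulmxE mxS2 mulNmx mul1mx.
    by rewrite !S2 !mulNmx mulmxN e.
  apply: iso_sym; apply: iso_trans (moveT_S2 _) _.
  by apply: iso_moveS; apply: iso_moveS; apply: iso_sym.
Qed.

Lemma normal_form_act A o o' : sl2z_act A o o' -> normal_form A o o'.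
Proof.
suff h : forall B o1, normal_form B o1 o -> sl2z_act A o o' -> normal_form (A *m B) o1 o'.
  move=> a; rewrite -[A]mulmx1; apply: h a.
  by exists 0, [::], 0; rewrite !expr0 !mul1mx; split=> //; apply: iso_refl.
move=> B o1 nB a; elim: a B o1 nB => {A o o'} [o s|o|o|A A' o o' o'' _ hA' _ hA] B o1 nB.
- by rewrite mul1mx; apply: normal_form_isor nB _; exists s.
- exact: normal_form_T.
- exact: normal_form_S.
- by rewrite -mulmxA; apply: hA; apply: hA'.
Qed.

End Action.

(** * Hyperbolic stabilisers as positive words *)

Section Reduction.
Local Open Scope ring_scope.
Variable N : nat.
Implicit Types (o : sqpair N) (A B : 'M[int]_2).

Lemma mat_word_cat w1 w2 : mat_word (w1 ++ w2) = mat_word w1 *m mat_word w2.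
Proof. by elim: w1 => [|x w1 IH] /=; rewrite ?mul1mx // IH mulmxA. Qed.

Lemma tr_mat_word_ge0 w : 0 <= \tr (mat_word w).
Proof.
suff [a [b [c [d [-> a0 b0 c0 d0]]]]] : exists a b c d,
    [/\ mat_word w = mx2 a (- b) (- c) d, 0 <= a, 0 <= b, 0 <= c & 0 <= d].
  by rewrite tr_mx2 addr_ge0.
elim: w => [|x w [a [b [c [d [/= -> a0 b0 c0 d0]]]]]].
  by exists 1, 0, 0, 1; rewrite /= one_mx2 !oppr0.
case: x; rewrite /mat_letter /mxTk /mxLk mul_mx2.
  by exists (a + c), (b + d), c, d; split; rewrite ?addr_ge0 //; congr mx2; ring.
by exists a, b, (a + c), (b + d); split; rewrite ?addr_ge0 //; congr mx2; ring.
Qed.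

Lemma iso_letter_iterS2 x n o :
  iso (letter x (iter n.*2 (@moveS N) o)) (iter n.*2 (@moveS N) (letter x o)).
Proof.
elim: n => [|n IH]; first exact: iso_refl.
apply: iso_trans (letter_S2 x _) _.
by apply: iso_moveS; apply: iso_moveS.
Qed.

Lemma letter_S_letter x y o :
  iso (letter y (moveS (letter x o)))
      (if x == y then iter (x : nat).*2 (@moveS N) (letter (~~ x) o) else moveS o).
Proof.
case: x; case: y => /=.
- by rewrite tSt; apply: iso_refl.
- by rewrite lSt; apply: iso_refl.
- exact: tSl.
- exact: lSl.
Qed.

Lemma mat_letter_S_letter x y : mat_letter y *m mxS *m mat_letter x =
  if x == y then mxS ^+ (x : nat).*2 *m mat_letter (~~ x) else mxS.
Proof.
case: x; case: y => /=; rewrite /mxTk /mxLk /mxS !mul_mx2 //.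
- by rewrite mxSX_even expr1 mulNmx mul1mx opp_mx2.
- by rewrite mul1mx.
Qed.

(** Moving the last letter of [w] to the front is a conjugation.  An odd power of S then
    stands between two letters, which collapse together with it, so the word gets shorter
    until the power of S is even.  It is then 1 and not -1, because words have
    non-negative trace. *)
Lemma cyclic_reduction w m o :
  iso (iter m (@moveS N) (word w o)) o -> 3 <= \tr (mxS ^+ m *m mat_word w) ->
  exists B o1 w1, [/\ sl2z_act B o o1, iso (word w1 o1) o1 &
    \tr (mat_word w1) = \tr (mxS ^+ m *m mat_word w)].
Proof.
have [k] := ubnP (size w); elim: k w m o => // k IH w m o szw h htr.
have [om|/even_halfK em] := boolP (odd m); last first.
  move: h htr; rewrite -em mxSX_even.
  have [ep|op] := boolP (odd m./2).
    by rewrite -signr_odd ep expr1 mulNmx mul1mx raddfN /= => _; move: (\tr _) (tr_mat_word_ge0 w); lia.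
  rewrite -signr_odd (negbTE op) expr0 mul1mx => h htr.
  exists 1%:M, o, w; split=> //; first exact: sl2z_act_refl.
  by move: h; rewrite -[m./2]even_halfK // -!mul2n mulnA mulnC moveS4X.
have mE : m = (m./2.*2).+1 by rewrite -{1}(odd_double_half m) om.
have SmE : mxS ^+ m = (-1) ^+ m./2 *m mxS by rewrite [in LHS]mE exprSr mxSX_even.
have iterE z : iter m (@moveS N) z = iter m./2.*2 (@moveS N) (moveS z).
  by rewrite [in LHS]mE iterSr.
have trS A : \tr (mxS ^+ m *m A) = (-1) ^+ m./2 * \tr (mxS *m A).
  rewrite SmE -mulmxA -signr_odd -[in RHS]signr_odd.
  by case: (odd _); rewrite ?expr0 ?expr1 ?mul1mx ?mul1r // mulN1r mulNmx mul1mx raddfN.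
have bound A : `|\tr (mxS *m A)| <= 1 -> \tr (mxS ^+ m *m A) < 3.
  rewrite trS -signr_odd; case: (odd _); rewrite ?expr0 ?expr1; move: (\tr _); lia.
case/lastP: w szw h htr => [|w y].
  by move=> _ _; rewrite leNgt bound // /= mulmx1 /mxS tr_mx2.
case: w => [|x w] szw h htr.
  move: htr; rewrite leNgt bound // /= mulmx1.
  by case: y {szw h}; rewrite /mat_letter /mxTk /mxLk /mxS mul_mx2 tr_mx2.
pose o1 := letter y o.
have oo1 : sl2z_act (mat_letter y) o o1 by apply: sl2z_act_letter.
have h1 : iso (letter y (iter m (@moveS N) (letter x (word w o1)))) o1.
  apply: iso_letter; move: h.
  by rewrite /word /= -cats1 foldr_cat.
have {}h1 : iso (iter m./2.*2 (@moveS N) (letter y (moveS (letter x (word w o1))))) o1.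
  apply: iso_trans (iso_sym _) h1; rewrite iterE; exact: iso_letter_iterS2.
have trE : \tr (mxS ^+ m *m mat_word (rcons (x :: w) y))
    = \tr (mxS ^+ m./2.*2 *m (mat_letter y *m mxS *m mat_letter x) *m mat_word w).
  rewrite -cats1 mat_word_cat /= mulmx1 !mulmxA mxtrace_mulC !mulmxA.
  congr (\tr (_ *m _ *m _)); rewrite SmE mxSX_even mulmxA; congr (_ *m _).
  rewrite -signr_odd; case: (odd _); rewrite ?expr0 ?expr1 ?mulmx1 ?mul1mx //.
  by rewrite mulmxN mulNmx mulmx1 mul1mx.
have := iso_iterS m./2.*2 (letter_S_letter x y (word w o1)).
move: trE; rewrite mat_letter_S_letter.
case: ifP => _ trE h2.
  have := IH (~~ x :: w) (m./2.*2 + (x : nat).*2)%N o1.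
  rewrite trE iterD exprD -!mulmxE mulmxA in htr *.
  case=> //.
  - by move: szw; rewrite size_rcons /=.
  - by apply: iso_trans (iso_sym h2) h1.
  - by move: htr; rewrite !mulmxA.
  move=> B [o2 [w1 [a b c]]]; exists (B *m mat_letter y), o2, w1; split=> //.
    exact: sl2z_act_mul oo1 a.
  by rewrite c /= !mulmxA.
have := IH w m o1.
have SmE' : mxS ^+ m = mxS ^+ m./2.*2 *m mxS by rewrite {1}mE exprSr.
case=> //.
- by move: szw; rewrite size_rcons /= ltnS; apply: ltnW.
- by rewrite iterE; apply: iso_trans (iso_sym h2) h1.
- by rewrite SmE' -trE.
move=> B [o2 [w1 [a b c]]]; exists (B *m mat_letter y), o2, w1; split=> //.
  exact: sl2z_act_mul oo1 a.
by rewrite c trE SmE'.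
Qed.

Lemma hyperbolic_word A o : sl2z_act A o o -> 3 <= \tr A ->
  exists B o1 w, [/\ sl2z_act B o o1, iso (word w o1) o1 & \tr (mat_word w) = \tr A].
Proof.
case/normal_form_act => i [w [j [-> h]]].
have -> : \tr (mxS ^+ i *m mat_word w *m mxS ^+ j) = \tr (mxS ^+ (j + i) *m mat_word w).
  by rewrite mxtrace_mulC exprD -mulmxE mulmxA.
pose o1 := iter j (@moveS N) o.
have h1 : iso (iter (j + i) (@moveS N) (word w o1)) o1.
  by rewrite iterD; apply: iso_iterS.
case/(cyclic_reduction h1) => B [o2 [w1 [a b c]]].
exists (B *m mxS ^+ j), o2, w1; split=> //.
exact: sl2z_act_mul (sl2z_act_iterS j o) a.
Qed.

End Reduction.

(** * Cellular cochains of an origami *)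

Section Cochains.
Local Open Scope ring_scope.
Variables (R : comNzRingType) (N : nat).
Implicit Types (o : sqpair N) (s p q : {perm 'I_N}).

(** For a row vector [a], [a *m permop p] is the function i |-> a (p i). *)
Definition permop p : 'M[R]_N := perm_mx p^-1%g.

Lemma permopM p q : permop p *m permop q = permop (q * p)%g.
Proof. by rewrite /permop invMg perm_mxM. Qed.

Lemma permop1 : permop 1 = 1%:M.
Proof. by rewrite /permop invg1 perm_mx1. Qed.

Lemma permopE m (A : 'M[R]_(m, N)) p i j : (A *m permop p) i j = A i (p j).
Proof. by rewrite /permop -col_permE mxE. Qed.

Lemma permop_mulE m (A : 'M[R]_(N, m)) p i j : (permop p *m A) i j = A (p^-1%g i) j.
Proof. by rewrite /permop -row_permE mxE. Qed.

(** The left half of a row vector holds the values of a cochain on the steps right, the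
    right half those on the steps up; [step x o] carries cochains of [o] to cochains of
    [letter x o].  A step of the new origami is a sum of steps of the old one, so the entries
    are non-negative. *)
Definition step x o : 'M[R]_(N + N) :=
  if x then block_mx 1%:M (permop o.2) 0 1%:M else block_mx (permop o.2) 0 1%:M 1%:M.

Fixpoint pull w o : 'M[R]_(N + N) :=
  if w is x :: w' then pull w' o *m step x (word w' o) else 1%:M.

Definition relabel s : 'M[R]_(N + N) := block_mx (permop s) 0 0 (permop s).

Definition cobound o : 'M[R]_(N, N + N) :=
  row_mx (permop o.1 - 1%:M) (permop o.2 - 1%:M).

(** The value of a cochain along the path right, up, left, down from a square [i], which
    ends at [corner o i]. *)
Definition corner_sum o : 'M[R]_(N + N, N) :=
  col_mx (1%:M - permop (o.1 * o.2 * o.1^-1)%g) (permop o.1 - permop (corner o)).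

(** If the square of the corner permutation is 1, the path of [corner_sum] run twice is
    closed; it turns once around a zero and twice around a regular vertex.  So a cochain
    is a cocycle of the surface when this map kills it. *)
Definition closing o : 'M[R]_(N + N, N) := corner_sum o *m (1%:M + permop (corner o)).

(** The cochains of the forms dx and dy. *)
Definition consts : 'M[R]_(1 + 1, N + N) := block_mx (const_mx 1) 0 0 (const_mx 1).
(** The transfer to the unit-square torus. *)
Definition totals : 'M[R]_(N + N, 1 + 1) := block_mx (const_mx 1) 0 0 (const_mx 1).

Definition lin_letter (x : bool) : 'M[R]_(1 + 1) :=
  if x then block_mx 1%:M 1%:M 0 1%:M else block_mx 1%:M 0 1%:M 1%:M.

Definition lin_word (w : seq bool) : 'M[R]_(1 + 1) :=
  foldr (fun x A => A *m lin_letter x) 1%:M w.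

Lemma const_permop m p : (const_mx 1 : 'M[R]_(m, N)) *m permop p = const_mx 1.
Proof. by apply/matrixP=> i j; rewrite permopE !mxE. Qed.

Lemma permop_const m p : permop p *m (const_mx 1 : 'M[R]_(N, m)) = const_mx 1.
Proof. by apply/matrixP=> i j; rewrite permop_mulE !mxE. Qed.

Lemma consts_step x o : consts *m step x o = lin_letter x *m consts.
Proof.
by case: x; rewrite /consts /step /lin_letter !mulmx_block
  !(mulmx0, mul0mx, mulmx1, mul1mx, addr0, add0r, const_permop).
Qed.

Lemma step_total x o : step x o *m totals = totals *m lin_letter x.
Proof.
by case: x; rewrite /totals /step /lin_letter !mulmx_block
  !(mulmx0, mul0mx, mulmx1, mul1mx, addr0, add0r, permop_const).
Qed.

Lemma consts_relabel s : consts *m relabel s = consts.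
Proof. by rewrite /consts /relabel mulmx_block !(mulmx0, mul0mx, addr0, add0r, const_permop). Qed.

Lemma relabel_total s : relabel s *m totals = totals.
Proof. by rewrite /totals /relabel mulmx_block !(mulmx0, mul0mx, addr0, add0r, permop_const). Qed.

Lemma consts_pull w o : consts *m pull w o = lin_word w *m consts.
Proof.
elim: w => [|x w IH] /=; first by rewrite mulmx1 mul1mx.
by rewrite mulmxA IH -mulmxA consts_step mulmxA.
Qed.

Lemma pull_total w o : pull w o *m totals = totals *m lin_word w.
Proof.
elim: w => [|x w IH] /=; first by rewrite mulmx1 mul1mx.
by rewrite -mulmxA step_total mulmxA IH -mulmxA.
Qed.

Lemma consts_total : consts *m totals = N%:R%:M.
Proof.
rewrite /consts /totals mulmx_block !(mulmx0, mul0mx, addr0, add0r).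
have -> : (const_mx 1 : 'M[R]_(1, N)) *m (const_mx 1 : 'M[R]_(N, 1)) = N%:R%:M.
  apply/matrixP=> i j; rewrite !ord1 !mxE eqxx mulr1n.
  under eq_bigr do rewrite !mxE mulr1.
  by rewrite sumr_const card_ord.
by rewrite -scalar_mx_block.
Qed.

Lemma cobound_total o : cobound o *m totals = 0.
Proof.
rewrite /cobound /totals mul_row_block !(mulmx0, addr0, add0r) !mulmxBl !permop_const.
by rewrite mul1mx !subrr row_mx0.
Qed.

Lemma consts_corner_sum o : consts *m corner_sum o = 0.
Proof.
rewrite /consts /corner_sum mul_block_col !(mul0mx, addr0, add0r) !mulmxBr !const_permop.
by rewrite mulmx1 !subrr col_mx0.
Qed.

Lemma consts_closing o : consts *m closing o = 0.
Proof. by rewrite mulmxA consts_corner_sum mul0mx. Qed.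

Lemma cobound_step x o : cobound o *m step x o = cobound (letter x o).
Proof.
case: x; rewrite /cobound /step mul_row_block /= !(mulmx0, addr0, add0r, mulmx1);
  congr row_mx; rewrite mulmxBl permopM mul1mx addrA subrK //.
Qed.

Lemma cobound_pull w o : cobound o *m pull w o = cobound (word w o).
Proof.
elim: w => [|x w IH] /=; first by rewrite mulmx1.
by rewrite mulmxA IH cobound_step.
Qed.

Lemma cobound_relabel o s : cobound (conj_pair o s) *m relabel s = permop s *m cobound o.
Proof.
rewrite /cobound /relabel mul_row_block !(mulmx0, addr0, add0r) mul_mx_row /=.
by congr row_mx; rewrite mulmxBl mulmxBr !permopM mul1mx mulmx1 /conjg !normg.
Qed.

Lemma corner_moveTV o : corner (moveTV o) = corner o.
Proof. by rewrite /corner /moveTV /= !normg. Qed.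

Lemma corner_moveLV o : corner (moveLV o) = (corner o ^ (o.2^-1))%g.
Proof. by rewrite /corner /moveLV /= /conjg !normg. Qed.

Lemma corner_conj o s : corner (conj_pair o s) = (corner o ^ s)%g.
Proof. by rewrite /corner /conj_pair /= !conjMg !conjVg. Qed.

Lemma corner_letter x o : exists s, corner (letter x o) = (corner o ^ s)%g.
Proof.
case: x; [exists 1%g|exists (o.2^-1)%g]; rewrite /= ?conjg1;
  [exact: corner_moveTV|exact: corner_moveLV].
Qed.

Definition corner_inv o : Prop := (corner o * corner o = 1)%g.

Lemma corner_inv_letter x o : corner_inv o -> corner_inv (letter x o).
Proof.
by rewrite /corner_inv; case: (corner_letter x o) => s ->; rewrite -conjMg => ->; rewrite conj1g.
Qed.

Lemma corner_inv_word w o : corner_inv o -> corner_inv (word w o).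
Proof. by move=> h; elim: w => //= x w; apply: corner_inv_letter. Qed.

(** For [moveLV] the path around a corner is conjugated by a step up.  The contributions
    of that step cancel along the corner run twice, which is where the square of the corner
    permutation being 1 is used. *)
Lemma step_closing x o : corner_inv o ->
  step x o *m closing (letter x o) =
  closing o *m (if x then 1%:M else permop o.2).
Proof.
move=> kk; case: x; rewrite /closing /step.
  rewrite mulmx1 mulmxA /= corner_moveTV; congr (_ *m _).
  rewrite /corner_sum mul_block_col /= !(mul0mx, add0r, mul1mx) corner_moveTV mulmxBr !permopM.
  congr col_mx; rewrite /moveTV /corner /= !normg addrA subrK //.
have kE : permop o.2 *m permop (corner (moveLV o)) = permop (corner o) *m permop o.2.
  by rewrite !permopM corner_moveLV /conjg !normg.
have -> : corner_sum o *m (1%:M + permop (corner o)) *m permop o.2 =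
  corner_sum o *m permop o.2 *m (1%:M + permop (corner (moveLV o))).
  by rewrite -!mulmxA; congr (_ *m _); rewrite mulmxDl mulmxDr mulmx1 mul1mx kE.
have -> : block_mx (permop o.2) 0 1%:M 1%:M *m (corner_sum (letter false o) *m
    (1%:M + permop (corner (letter false o)))) =
  (corner_sum o *m permop o.2 + col_mx 0 (1%:M - permop (corner (moveLV o)))) *m
    (1%:M + permop (corner (moveLV o))).
  rewrite mulmxA; congr (_ *m _); rewrite /corner_sum mul_block_col mul_col_mx.
  rewrite !(mul0mx, addr0, mul1mx) !mulmxBl !mulmxBr !mul1mx !mulmx1 !permopM add_col_mx addr0.
  congr col_mx; first by rewrite /= !normg.
  have -> : ((letter false o).1 * (letter false o).2 * (letter false o).1^-1 =
             o.2 * corner o)%g by rewrite /corner /= !normg.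
  by rewrite addrACA [RHS]addrACA [1%:M + _]addrC.
have k1 : permop (corner (moveLV o)) *m permop (corner (moveLV o)) = 1%:M.
  by rewrite permopM (corner_inv_letter false kk) permop1.
rewrite mulmxDl [col_mx 0 _ *m _]mul_col_mx mul0mx.
have -> : (1%:M - permop (corner (moveLV o))) *m (1%:M + permop (corner (moveLV o))) = 0.
  by rewrite mulmxBl !mulmxDr !mulmx1 !mul1mx k1 [_ + 1%:M]addrC subrr.
by rewrite col_mx0 addr0.
Qed.

Lemma pull_closing w o : corner_inv o ->
  exists Y, pull w o *m closing (word w o) = closing o *m Y.
Proof.
move=> kk; elim: w => [|x w [Y IH]] /=; first by exists 1%:M; rewrite mul1mx mulmx1.
rewrite -mulmxA step_closing; last exact: corner_inv_word.
by rewrite mulmxA IH -mulmxA; exists (Y *m (if x then 1%:M else permop (word w o).2)).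
Qed.

Lemma relabel_closing o s : relabel s *m closing o = closing (conj_pair o s) *m permop s.
Proof.
rewrite /closing mulmxA.
have -> : relabel s *m corner_sum o = corner_sum (conj_pair o s) *m permop s.
  rewrite /relabel /corner_sum mul_block_col !(mul0mx, addr0, add0r) mul_col_mx corner_conj.
  congr col_mx; rewrite mulmxBr mulmxBl !permopM ?mulmx1 ?mul1mx /conj_pair /= -?conjVg -?conjMg;
    by rewrite /conjg !normg.
rewrite -!mulmxA corner_conj; congr (_ *m _).
by rewrite mulmxDr mulmxDl mulmx1 mul1mx !permopM /conjg !normg.
Qed.

End Cochains.

Lemma map_permop (R : comNzRingType) N (p : {perm 'I_N}) :
  map_mx (intr : int -> R) (permop int p) = permop R p.
Proof. exact: map_perm_mx. Qed.

Lemma map_pull (R : comNzRingType) N w (o : sqpair N) :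
  map_mx (intr : int -> R) (pull int w o) = pull R w o.
Proof.
have mstep x (o' : sqpair N) : map_mx (intr : int -> R) (step int x o') = step R x o'.
  by case: x; rewrite /step map_block_mx !map_mx1 map_perm_mx map_mx0.
elim: w => [|x w IH] /=; first by rewrite map_mx1.
by rewrite map_mxM mstep IH.
Qed.

Lemma map_relabel (R : comNzRingType) N (s : {perm 'I_N}) :
  map_mx (intr : int -> R) (relabel int s) = relabel R s.
Proof. by rewrite /relabel map_block_mx map_perm_mx map_mx0. Qed.

Lemma map_closing (R : comNzRingType) N (o : sqpair N) :
  map_mx (intr : int -> R) (closing int o) = closing R o.
Proof.
by rewrite /closing /corner_sum map_mxM map_col_mx !(map_mxD, map_mxN, map_mx1, map_permop).
Qed.

Lemma map_cobound (R : comNzRingType) N (o : sqpair N) :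
  map_mx (intr : int -> R) (cobound int o) = cobound R o.
Proof. by rewrite /cobound map_row_mx !(map_mxD, map_mxN, map_mx1, map_permop). Qed.

Lemma map_consts (R : comNzRingType) N :
  map_mx (intr : int -> R) (consts int N) = consts R N.
Proof. by rewrite /consts map_block_mx !map_const_mx rmorph1 rmorph0. Qed.

Lemma map_total (R : comNzRingType) N :
  map_mx (intr : int -> R) (totals int N) = totals R N.
Proof. by rewrite /totals map_block_mx !map_const_mx rmorph1 rmorph0. Qed.

Lemma map_lin_word (R : comNzRingType) w :
  map_mx (intr : int -> R) (lin_word int w) = lin_word R w.
Proof.
elim: w => [|x w IH] /=; first by rewrite map_mx1.
by rewrite map_mxM IH; congr mulmx; case: x; rewrite /lin_letter map_block_mx !map_mx1 map_mx0.
Qed.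

(** * Dimension of the cohomology complement *)

(** Transitivity, in a form that is immediate to carry along the moves. *)
Definition connected_pair N (o : sqpair N) : Prop := forall f : 'I_N -> bool,
  (forall i, f (o.1 i) = f i) -> (forall i, f (o.2 i) = f i) -> forall i j, f i = f j.

Lemma connected_origamis N (o : sqpair N) : o \in origamis N -> connected_pair o.
Proof.
rewrite inE => tr f f1 f2 i j.
pose A := [set s : {perm 'I_N} | [forall k, f (s k) == f k]]%SET.
have gA : group_set A.
  apply/group_setP; split; first by rewrite inE; apply/forallP=> k; rewrite perm1.
  move=> s t; rewrite !inE => /forallP fs /forallP ft; apply/forallP=> k.
  by rewrite permM (eqP (ft _)) fs.
have sub : monodromy o \subset A.
  rewrite /monodromy /= (_ : A = Group gA) // gen_subG.
  apply/fintype.subsetP=> s; rewrite !inE => /orP[] /eqP ->; apply/forallP=> k; apply/eqP;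
    [exact: f1|exact: f2].
have [s sG ->] := atransP2 tr (finset.in_setT j) (finset.in_setT i).
by have := fintype.subsetP sub _ sG; rewrite inE => /forallP/(_ j)/eqP.
Qed.

Lemma invariant_const N (o : sqpair N) (T : eqType) (f : 'I_N -> T) :
  connected_pair o -> (forall i, f (o.1 i) = f i) -> (forall i, f (o.2 i) = f i) ->
  forall i j, f i = f j.
Proof.
move=> co f1 f2 i j; have := co (fun k => f k == f j) _ _ i j.
by rewrite eqxx => h; apply/eqP; apply: h => k; rewrite ?f1 ?f2.
Qed.

Section Dimension.
Local Open Scope ring_scope.
Variables (F : numFieldType) (N : nat) (o : sqpair N).
Hypothesis N_gt0 : (0 < N)%N.
Hypothesis o_tr : connected_pair o.
Hypothesis o_inv : corner_inv o.
Variables p r : 'I_N.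
Hypothesis o_moved : forall i, corner o i != i -> i \in [:: p; corner o p; r; corner o r].

Local Notation D := (@cobound F N o).
Local Notation C := (@closing F N o).
Local Notation tot := (@totals F N).

Lemma cobound_closing : D *m C = 0.
Proof.
have -> : D *m C = (permop F (corner o) - 1%:M) *m (1%:M + permop F (corner o)).
  rewrite mulmxA; congr (_ *m _); rewrite /cobound /corner_sum mul_row_col.
  rewrite !mulmxBl !mulmxBr !mul1mx !mulmx1 !permopM /corner !normg.
  move: (permop _ _) (permop _ _) (permop _ _) (permop _ _) => a b c d.
  by apply/matrixP=> i j; rewrite !mxE; ring.
rewrite mulmxBl !mulmxDr !mulmx1 !mul1mx permopM o_inv permop1.
by rewrite [_ + 1%:M]addrC subrr.
Qed.

Lemma cobound_kernel m (G : 'M[F]_(m, N)) : G *m D = 0 -> (G <= (const_mx 1 : 'rV_N))%MS.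
Proof.
rewrite /cobound mul_mx_row -[0 in RHS]row_mx0 => /eq_row_mx[].
rewrite !mulmxBr !mulmx1 => /subr0_eq e1 /subr0_eq e2.
apply/row_subP=> i; apply/sub_rVP; exists (G i (Ordinal N_gt0)).
apply/rowP=> j; rewrite !mxE mulr1.
apply: (invariant_const (f := G i) o_tr) => k.
  by have /matrixP/(_ i k) := e1; rewrite permopE.
by have /matrixP/(_ i k) := e2; rewrite permopE.
Qed.

Lemma corner_sum_kernel (psi : 'cV[F]_N) : corner_sum F o *m psi = 0 ->
  forall i j, psi i 0 = psi j 0.
Proof.
rewrite /corner_sum mul_col_mx -[0 in RHS]col_mx0 => /eq_col_mx[].
rewrite !mulmxBl mul1mx => /subr0_eq e1 /subr0_eq e2.
pose th j := psi (o.1^-1%g j) 0.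
have thv j : th (o.2 j) = th j.
  have /matrixP/(_ (o.1^-1%g (o.2 j)) 0) := e1; rewrite permop_mulE /th => ->.
  by congr (psi _ 0); rewrite !invMg !invgK !permM permKV permK.
have thh j : th (o.1 j) = th j.
  have /matrixP/(_ (corner o (o.1^-1%g (o.2^-1%g (o.1 j)))) 0) := e2.
  rewrite !permop_mulE permK /th.
  have -> : (o.1^-1 (corner o (o.1^-1 (o.2^-1 (o.1 j)))))%g = (o.1^-1 (o.2^-1 j))%g.
    by rewrite /corner !permM permKV permKV permK.
  have := thv (o.2^-1 j)%g; rewrite /th permKV => -> ->.
  by have := thv (o.2^-1 (o.1 j))%g; rewrite /th permKV => ->.
move=> i j; have := invariant_const o_tr thh thv (o.1 i) (o.1 j).
by rewrite /th !permK.
Qed.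

Definition constraints : 'M[F]_(N + N, N + (1 + 1)) := row_mx C tot.

(** The form dx pairs to zero with the closing conditions and to [N] with its own total,
    so a linear relation between the constraints involves the closing conditions alone.
    Averaged over the corner permutation it is invariant under both permutations of the
    origami, hence constant; three coordinates then determine it. *)
Lemma constraints_kernel (v : 'cV[F]_(N + (1 + 1))) : constraints *m v = 0 ->
  v (lshift _ p) 0 = 0 -> v (lshift _ (corner o p)) 0 = 0 -> v (lshift _ r) 0 = 0 -> v = 0.
Proof.
rewrite -[v]vsubmxK; set phi := usubmx v; set x := dsubmx v.
rewrite !col_mxEu /constraints mul_row_col; move: phi x => phi x e vp vkp vr.
have x0 : x = 0.
  have := congr1 (mulmx (consts F N)) e.
  rewrite mulmxDr (mulmxA _ C) (mulmxA _ tot) consts_closing mul0mx add0r consts_total mulmx0 mul_scalar_mx.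
  move/eqP; rewrite scaler_eq0 => /orP[|/eqP //]; by rewrite pnatr_eq0 eqn0Ngt N_gt0.
move: e; rewrite x0 mulmx0 addr0 -mulmxA => /corner_sum_kernel th.
have phiE i : phi i 0 + phi (corner o i) 0 = 0.
  have k_inv j : (corner o)^-1%g j = corner o j.
    by apply: (@perm_inj _ (corner o)); rewrite permKV -permM o_inv perm1.
  have := th i p; rewrite mulmxDl mul1mx !mxE.
  have E m : \sum_j permop F (corner o) m j * phi j 0 = phi (corner o m) 0.
    by rewrite -k_inv -(permop_mulE phi) mxE.
  by rewrite !E vp vkp addr0.
have vkr : phi (corner o r) 0 = 0 by have := phiE r; rewrite vr add0r.
suff -> : phi = 0 by rewrite col_mx0.
apply/colP=> i; rewrite [RHS]mxE.
have [fi|mi] := eqVneq (corner o i) i.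
  by have /eqP := phiE i; rewrite fi -mulr2n mulrn_eq0 => /eqP.
by have := o_moved mi; rewrite !inE => /or4P[] /eqP ->.
Qed.

Lemma rank_constraints : (N.-1 <= \rank constraints)%N.
Proof.
pose f (k : 'I_3) : 'I_(N + (1 + 1)) := lshift _ (nth p [:: p; corner o p; r] k).
pose E : 'M[F]_(N + (1 + 1), 3) := \matrix_(i, j) (i == f j)%:R.
have vE (v : 'rV_(N + (1+1))) j : (v *m E) 0 j = v 0 (f j).
  rewrite mxE (bigD1 (f j)) //= big1 => [|i /negbTE ni]; rewrite mxE ?eqxx ?mulr1 ?addr0 //.
  by rewrite ni mulr0.
have cap0 : (kermx constraints^T :&: kermx E)%MS = 0.
  apply/eqP; rewrite -submx0; apply/rV_subP=> v; rewrite sub_capmx => /andP[/sub_kermxP v1 /sub_kermxP v2].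
  have /constraints_kernel v0 : constraints *m v^T = 0.
    by rewrite -[constraints]trmxK -trmx_mul v1 trmx0.
  have vz j : v 0 (f j) = 0 by rewrite -vE v2 mxE.
  suff : v^T = 0 by move/(congr1 trmx); rewrite trmxK trmx0 => ->; rewrite submx0.
  apply: v0; rewrite mxE; first exact: (vz 0).
    exact: (vz 1).
  exact: (vz (lift 0 1)).
have := mxrank_mul_ker (kermx constraints^T) E; rewrite cap0 mxrank0 addn0.
rewrite mxrank_ker mxrank_tr => e.
have := rank_leq_col (kermx constraints^T *m E); rewrite e.
have := rank_leq_col constraints; have := rank_leq_row constraints; lia.
Qed.

(** There are N + 2 constraints with at most 3 relations, so cocycles with zero totals
    have dimension at most N + 1.  Coboundaries have dimension N - 1, constants being the
    only functions with zero coboundary.  The quotient has dimension at most 2. *)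
Lemma cocycle_dependence (y : 'M[F]_(3, N + N)) : y *m C = 0 -> y *m tot = 0 ->
  exists2 al : 'rV[F]_3, al != 0 & (al *m y <= D)%MS.
Proof.
move=> yC yt; pose Z := col_mx y D.
have ZG : Z *m constraints = 0.
  by rewrite /Z /constraints mul_col_row yC yt cobound_closing cobound_total block_mx0.
have rZ : (\rank Z <= N.+1)%N.
  have /mxrankS : (Z <= kermx constraints)%MS by apply/sub_kermxP.
  rewrite mxrank_ker; have := rank_constraints; lia.
have rK : (2 <= \rank (kermx Z))%N by rewrite mxrank_ker; lia.
have [K0|] := eqVneq (lsubmx (kermx Z)) 0.
  have e : rsubmx (kermx Z) *m D = 0.
    have := mulmx_ker Z; rewrite -{1}[kermx Z]hsubmxK K0 mul_row_col mul0mx add0r //.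
  have s1 : (kermx Z <= row_mx (0 : 'rV[F]_3) (const_mx 1 : 'rV_N))%MS.
    rewrite -[X in (X <= _)%MS]hsubmxK K0.
    have /submxP[W ->] := cobound_kernel e.
    by rewrite -{1}(mulmx0 _ W) -mul_mx_row submxMl.
  have := leq_trans rK (leq_trans (mxrankS s1) (rank_leq_row _)); by [].
case/matrix0Pn => i [j nz]; exists (lsubmx (row i (kermx Z))).
  by apply/matrix0Pn; exists 0, j; move: nz; rewrite !mxE.
have e : row i (kermx Z) *m Z = 0 by rewrite -row_mul mulmx_ker row0.
move: e; rewrite -{1}[row i _]hsubmxK mul_row_col => /eqP; rewrite addr_eq0 => /eqP ->.
by rewrite -mulNmx submxMl.
Qed.

End Dimension.

(** * Zero sets of non-negative eigencochains *)

Lemma connected_letter N x (o : sqpair N) : connected_pair o -> connected_pair (letter x o).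
Proof.
move=> co f f1 f2; case: x f1 f2 => /= f1 f2; apply: co => // i.
  by have := f2 i; rewrite permM f1.
by have := f1 (o.2^-1 i)%g; rewrite permM permKV => ->; have := f2 (o.2^-1 i)%g; rewrite permKV.
Qed.

Lemma connected_word N w (o : sqpair N) : connected_pair o -> connected_pair (word w o).
Proof. by move=> co; elim: w => //= x w; apply: connected_letter. Qed.

Section ZeroSets.
Local Open Scope set_scope.
Variable N : nat.
Implicit Types (o : sqpair N) (A B : {set 'I_N}).

(** A sum of non-negative numbers vanishes when both terms do. *)
Definition zstep x o (AB : {set 'I_N} * {set 'I_N}) :=
  if x then (AB.1, AB.2 :&: o.2 @^-1: AB.1) else (o.2 @^-1: AB.1 :&: AB.2, AB.2).

Fixpoint zsets w o AB :=
  if w is x :: w' then zstep x (word w' o) (zsets w' o AB) else AB.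

Definition same_size (AB AB' : {set 'I_N} * {set 'I_N}) :=
  #|AB.1| = #|AB'.1| /\ #|AB.2| = #|AB'.2|.

Lemma card_preim_perm (s : {perm 'I_N}) A : #|s @^-1: A| = #|A|.
Proof. exact: card_preimset (@perm_inj _ s). Qed.

Lemma zsets_le w o AB :
  (#|(zsets w o AB).1| <= #|AB.1|)%N /\ (#|(zsets w o AB).2| <= #|AB.2|)%N.
Proof.
elim: w => //= x w; case: (zsets w o AB) => A B /= [hA hB].
case: x => /=; split=> //.
  exact: leq_trans (subset_leq_card (finset.subsetIl _ _)) hB.
by apply: leq_trans hA; rewrite -(card_preim_perm (word w o).2 A);
  exact: subset_leq_card (finset.subsetIl _ _).
Qed.

Lemma zsets_same_cons x w o AB : same_size (zsets (x :: w) o AB) AB ->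
  same_size (zsets w o AB) AB /\
  let V := (word w o).2 in let A := (zsets w o AB).1 in let B := (zsets w o AB).2 in
  if x then B \subset V @^-1: A else V @^-1: A \subset B.
Proof.
have := zsets_le w o AB; rewrite /same_size /=.
case: (zsets w o AB) => A B /= [hA hB].
case: x => /= -[eA eB].
  have le : (#|B :&: (word w o).2 @^-1: A| <= #|B|)%N.
    exact: subset_leq_card (finset.subsetIl _ _).
  split; first by split=> //; apply/eqP; rewrite eqn_leq hB -eB.
  apply/finset.setIidPl/eqP; rewrite finset.eqEcard finset.subsetIl /= eB; exact: hB.
have le : (#|(word w o).2 @^-1: A :&: B| <= #|A|)%N.
  rewrite -(card_preim_perm (word w o).2 A); exact: subset_leq_card (finset.subsetIl _ _).
split; first by split=> //; apply/eqP; rewrite eqn_leq hA -eA.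
apply/finset.setIidPl/eqP; rewrite finset.eqEcard finset.subsetIl /= eA card_preim_perm; exact: hA.
Qed.

Lemma zsets_card w o AB : same_size (zsets w o AB) AB ->
  (true \in w -> (#|AB.2| <= #|AB.1|)%N) /\ (false \in w -> (#|AB.1| <= #|AB.2|)%N).
Proof.
elim: w => // x w IH /zsets_same_cons [ss sub]; have [IHt IHf] := IH ss.
have [e1 e2] := ss; move: sub => /=.
case: x => /subset_leq_card; rewrite card_preim_perm e1 e2 !inE /= => le.
  by split.
by split.
Qed.

Lemma zsets_diag w o AB : same_size (zsets w o AB) AB -> #|AB.1| = #|AB.2| ->
  false \in w -> (zsets w o AB).1 = (zsets w o AB).2.
Proof.
move=> + ee; elim: w => // x w IH /zsets_same_cons[ss sub].
have [e1 e2] := ss; move: sub => /=.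
case: x; rewrite !inE /= => sub.
  by move=> /(IH ss) e; rewrite (finset.setIidPl sub).
move=> _; rewrite (finset.setIidPl sub); apply/eqP.
by rewrite finset.eqEcard sub card_preim_perm e1 e2 ee /=.
Qed.

Lemma zsets_invariant w o A : same_size (zsets w o (A, A)) (A, A) ->
  zsets w o (A, A) = (A, A) /\
  forall w1 x w2, w = w1 ++ x :: w2 -> (word w2 o).2 @^-1: A = A.
Proof.
elim: w => [|y w IH]; first by split=> // -[].
move=> /zsets_same_cons[ss sub]; have [e inv] := IH ss.
move: sub; rewrite /= e /= => sub.
have VA : (word w o).2 @^-1: A = A.
  by apply/eqP; case: y sub => sub; [rewrite eq_sym|]; rewrite finset.eqEcard sub card_preim_perm /=.
split; first by case: y {sub} => /=; rewrite VA finset.setIid.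
by case=> [|z w1] x w2 /= [_ ew]; [rewrite -ew | apply: inv ew].
Qed.

(** The sizes cannot drop along a word that returns to the starting origami, so each
    inclusion met on the way is an equality.  One letter of each kind makes the two sets
    equal and invariant under both permutations. *)
Lemma zsets_trivial w o s AB : connected_pair o -> word w o = conj_pair o s ->
  true \in w -> false \in w ->
  AB = (s @^-1: (zsets w o AB).1, s @^-1: (zsets w o AB).2) ->
  AB = (finset.set0, finset.set0) \/ AB = ([set: _], [set: _]).
Proof.
move=> co ew tw fw eAB.
have ss : same_size (zsets w o AB) AB.
  by split; rewrite [in RHS]eAB card_preim_perm.
have [/(_ tw) le1 /(_ fw) le2] := zsets_card ss.
have ee : #|AB.1| = #|AB.2| by apply/eqP; rewrite eqn_leq le2.
have diag := zsets_diag ss ee fw.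
have e12 : AB.1 = AB.2 by rewrite eAB /= diag.
move: ss eAB; rewrite [AB]surjective_pairing -e12; set A := AB.1 => ss eAB.
have [eA inv] := zsets_invariant ss.
have sA : s @^-1: A = A by move: eAB; rewrite eA => -[].
have oA : o.2 @^-1: A = A.
  by case/lastP: w {ew tw fw ss eAB diag eA} inv fw => // w x inv _;
    apply: (inv w x [::]); rewrite -cats1.
have vA : (word w o).2 @^-1: A = A.
  have sAE i : (s i \in A) = (i \in A) by rewrite -{2}sA inE.
  have oAE i : (o.2 i \in A) = (i \in A) by rewrite -{2}oA inE.
  apply/setP=> i; rewrite ew inE /= conjgE !permM sAE oAE.
  by rewrite -sAE permKV.
have [w1 [w2 e]] : exists w1 w2, w = w1 ++ true :: w2.
  by case/splitPr: tw => w1 w2; exists w1, w2.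
have A2 := inv _ _ _ e.
have A3 : (word (true :: w2) o).2 @^-1: A = A.
  case/lastP: w1 e => [|w1 y] e; first by rewrite -[true :: w2]e.
  by apply: (inv w1 y); rewrite e cat_rcons.
have f2 i : ((word w2 o).2 i \in A) = (i \in A) by rewrite -{2}A2 inE.
have f1 i : ((word w2 o).1 i \in A) = (i \in A).
  have /setP/(_ ((word w2 o).2^-1 i)%g) := A3; rewrite inE /= permM permKV => ->.
  by rewrite -f2 permKV.
have cst := connected_word co f1 f2.
case: (set_0Vmem A) => [->|[i iA]]; [by left|right].
by have -> : A = [set: _] by apply/setP=> j; rewrite inE; apply: etrans (cst j i) iA.
Qed.

End ZeroSets.

(** * The Perron-Frobenius argument *)

Section Entries.
Local Open Scope ring_scope.
Variables (R : comNzRingType) (N : nat).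
Implicit Types (o : sqpair N) (c : 'rV[R]_(N + N)).

Lemma step_entries x o c i :
  (c *m step R x o) 0 (lshift N i) =
    (if x then c 0 (lshift N i) else c 0 (lshift N (o.2 i)) + c 0 (rshift N i)) /\
  (c *m step R x o) 0 (rshift N i) =
    (if x then c 0 (lshift N (o.2 i)) + c 0 (rshift N i) else c 0 (rshift N i)).
Proof.
rewrite -[c]hsubmxK; move: (lsubmx c) (rsubmx c) => a b.
by case: x; rewrite /step mul_row_block !(row_mxEl, row_mxEr) !(mulmx1, mulmx0, addr0, add0r);
  split; rewrite // mxE permopE.
Qed.

Lemma relabel_entries s c i :
  (c *m relabel R s) 0 (lshift N i) = c 0 (lshift N (s i)) /\
  (c *m relabel R s) 0 (rshift N i) = c 0 (rshift N (s i)).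
Proof.
rewrite -[c]hsubmxK; move: (lsubmx c) (rsubmx c) => a b.
by rewrite /relabel mul_row_block !(row_mxEl, row_mxEr) !(mulmx1, mulmx0, addr0, add0r) !permopE.
Qed.

Lemma consts_entries (u : 'rV[R]_(1 + 1)) i :
  (u *m consts R N) 0 (lshift N i) = u 0 0 /\ (u *m consts R N) 0 (rshift N i) = u 0 1.
Proof.
rewrite -{1 3}[u]hsubmxK /consts mul_row_block !(row_mxEl, row_mxEr) !(mulmx0, addr0, add0r).
by rewrite !mxE !big_ord1 !mxE !mulr1; split; congr (u _ _); apply: val_inj.
Qed.

End Entries.

Section PerronFrobenius.
Local Open Scope ring_scope.
Variables (F : realFieldType) (N : nat).
Implicit Types (o : sqpair N) (c z : 'rV[F]_(N + N)).

Definition nonneg z := forall e, 0 <= z 0 e.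
Definition zeros z : {set 'I_N} * {set 'I_N} :=
  ([set i | z 0 (lshift N i) == 0]%SET, [set i | z 0 (rshift N i) == 0]%SET).

Lemma nonneg_step x o z : nonneg z -> nonneg (z *m step F x o).
Proof.
move=> z0 e; case: (split_ordP e) => i ->; have [e1 e2] := step_entries x o z i;
  by rewrite ?e1 ?e2; case: x {e1 e2}; rewrite ?addr_ge0.
Qed.

Lemma nonneg_pull w o z : nonneg z -> nonneg (z *m pull F w o).
Proof.
elim: w => [|x w IH] z0 /=; first by rewrite mulmx1.
by rewrite mulmxA; apply: nonneg_step; apply: IH.
Qed.

Lemma zeros_pull w o z : nonneg z -> zeros (z *m pull F w o) = zsets w o (zeros z).
Proof.
move=> z0; elim: w => [|x w IH] /=; first by rewrite mulmx1.
rewrite -IH mulmxA; move: (nonneg_pull w o z0); set z' := z *m _ => z0'.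
rewrite /zeros /zstep /=.
have e := step_entries x (word w o) z'.
by case: x e => e; congr (_, _); apply/setP=> i; have [e1 e2] := e i;
  rewrite !inE ?e1 ?e2 //= paddr_eq0 // andbC.
Qed.

(** Subtract from [c] the largest multiple of the positive eigenvector [u0 *m consts] that
    stays below it: the difference is a non-negative eigenvector with a zero entry, so it
    vanishes by [zsets_trivial].  Hence [c] is constant, and its total is zero. *)
Lemma perron_frobenius o w s (lam : F) (c : 'rV[F]_(N + N)) (u0 : 'rV[F]_(1 + 1)) :
  (0 < N)%N -> connected_pair o -> word w o = conj_pair o s -> true \in w -> false \in w ->
  0 < lam -> 0 < u0 0 0 -> 0 < u0 0 1 -> u0 *m lin_word F w = lam *: u0 ->
  c *m pull F w o *m relabel F s = lam *: c -> c *m totals F N = 0 -> c = 0.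
Proof.
move=> N0 co ew tw fw lam0 u00 u01 eu ec tc.
pose W := u0 *m consts F N.
have W0 e : 0 < W 0 e.
  by case: (split_ordP e) => i ->; have [e1 e2] := @consts_entries _ N u0 i;
    rewrite /W ?e1 ?e2.
have eW : W *m pull F w o *m relabel F s = lam *: W.
  by rewrite /W -(mulmxA u0) consts_pull mulmxA eu -mulmxA consts_relabel scalemxAl.
have tW : W *m totals F N = N%:R *: u0.
  by rewrite /W -mulmxA consts_total mul_mx_scalar.
clearbody W.
pose e0 : 'I_(N + N) := lshift N (Ordinal N0).
pose e1 := [arg min_(e < e0) (c 0 e / W 0 e)]%O.
pose th := c 0 e1 / W 0 e1.
have th_le e : th <= c 0 e / W 0 e by rewrite /th /e1; case: arg_minP => // i _; apply.
pose z := c - th *: W.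
have z0 : nonneg z.
  by move=> e; rewrite !mxE subr_ge0 -ler_pdivlMr // th_le.
have ez : z *m pull F w o *m relabel F s = lam *: z.
  by rewrite !mulmxBl ec -!scalemxAl eW scalerBr !scalerA mulrC.
have z_e1 : z 0 e1 = 0 by rewrite !mxE /th divfK ?subrr // gt_eqF.
have ecW : z = 0 -> c = th *: W by move/eqP; rewrite subr_eq0 => /eqP.
clearbody z.
have zE : zeros z = (s @^-1: (zsets w o (zeros z)).1, s @^-1: (zsets w o (zeros z)).2)%SET.
  rewrite -zeros_pull //; congr (_, _); apply/setP=> i; rewrite !inE.
    have [<- _] := relabel_entries s (z *m pull F w o) i.
    by rewrite ez mxE mulf_eq0 (gt_eqF lam0).
  have [_ <-] := relabel_entries s (z *m pull F w o) i.
  by rewrite ez mxE mulf_eq0 (gt_eqF lam0).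
have [Z|Z] := zsets_trivial co ew tw fw zE.
  case: (split_ordP e1) z_e1 => i -> zi.
    by case: Z => /setP/(_ i) + _; rewrite !inE zi eqxx.
  by case: Z => _ /setP/(_ i); rewrite !inE zi eqxx.
have zz : z = 0.
  apply/rowP=> e; rewrite [RHS]mxE; case: Z => Z1 Z2; apply/eqP.
  by case: (split_ordP e) => i ->; [move/setP/(_ i): Z1 | move/setP/(_ i): Z2]; rewrite !inE.
move: tc; rewrite (ecW zz) -scalemxAl tW scalerA => /eqP.
rewrite scaler_eq0 mulf_eq0 pnatr_eq0 (gtn_eqF N0) orbF => /orP[/eqP ->|/eqP u00'].
  by rewrite scale0r.
by move: u00; rewrite u00' mxE ltxx.
Qed.

End PerronFrobenius.

(** * Periods and their transport *)

Section SubgroupGenerated.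
Local Open Scope ring_scope.
Variables (V : zmodType).

Definition subgroup_like (H : set V) := H 0 /\ forall x y, H x -> H y -> H (x - y).

Lemma subgroup_generated_min (G H : set V) : subgroup_like H -> (G `<=` H)%classic ->
  (subgroup_generated G `<=` H)%classic.
Proof. by move=> sH GH z; apply. Qed.

Lemma subgroup_generated_sub (G : set V) : (G `<=` subgroup_generated G)%classic.
Proof. by move=> z Gz H [_ GH]; apply: GH. Qed.

Lemma subgroup_generated_subgroup (G : set V) : subgroup_like (subgroup_generated G).
Proof.
split=> [H [[H0 _] _] //|x y hx hy H HP]; have [[_ HB] _] := HP.
by apply: HB; [apply: hx | apply: hy].
Qed.

Lemma subgroup_likeD (H : set V) x y : subgroup_like H -> H x -> H y -> H (x + y).
Proof.
case=> H0 HB hx hy; rewrite -[y]opprK; apply: (HB) => //.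
by rewrite -sub0r; apply: HB.
Qed.

Lemma subgroup_like_muln (H : set V) x n : subgroup_like H -> H x -> H (x *+ n).
Proof.
move=> sH hx; elim: n => [|n IH]; first by rewrite mulr0n; case: sH.
by rewrite mulrS; apply: subgroup_likeD.
Qed.

(** Two of the n + 1 multiples 0, x, ..., n x lie in the same coset of [H], so some
    k x with 0 < k <= n is in [H], and k divides n!. *)
Lemma has_index_fact (H : set V) n : subgroup_like H -> has_index H setT n ->
  forall x, H (x *+ n`!).
Proof.
move=> sH [_ card] x.
have [k [l [kl ln Hkl]]] : exists k l, [/\ (k < l)%N, (l <= n)%N & H (x *+ l - x *+ k)].
  pose cs (k : nat) : set V := [set y | H (y - x *+ k)]%classic.
  have /pcard_leP[f] : ([set [set y | H (y - z)] | z in [set: V]] #<= `I_n)%classic%card.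
    by move: card; rewrite card_eq_le => /andP[].
  have inA k : [set [set y | H (y - z)] | z in [set: V]]%classic (cs k).
    by exists (x *+ k).
  have fn k : (f (cs k) < n)%N by exact: (@funS _ _ _ _ f _ (inA k)).
  have : ~~ injectiveb (fun k : 'I_n.+1 => Ordinal (fn k)).
    apply/negP=> /injectiveP /leq_card; rewrite !card_ord; by rewrite ltnn.
  case/injectivePn => k [l kl /(congr1 val) /= fkl].
  have e : cs k = cs l by apply: inj fkl; apply/mem_set.
  have Hkl : H (x *+ l - x *+ k).
    have : cs l (x *+ l) by rewrite /cs /= subrr; case: sH.
    by rewrite -e.
  have Hlk : H (x *+ k - x *+ l).
    have : cs k (x *+ k) by rewrite /cs /= subrr; case: sH.
    by rewrite e.
  have [kl'|kl'] : (k < l)%N \/ (l < k)%N.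
    by apply/orP; rewrite -neq_ltn; apply: contra_neq kl => /val_inj.
  - by exists k, l; split=> //; rewrite -ltnS ltn_ord.
  - by exists l, k; split=> //; rewrite -ltnS ltn_ord.
have /dvdnP[q ->] : (l - k %| n`!)%N.
  apply: dvdn_fact; rewrite subn_gt0 kl; apply: leq_trans ln; exact: leq_subr.
rewrite mulnC mulrnA; apply: subgroup_like_muln => //.
by rewrite mulrnBr // ltnW.
Qed.

End SubgroupGenerated.

Section Walks.
Local Open Scope ring_scope.
Variable N : nat.
Implicit Types (o : sqpair N) (z : int * int).

Lemma Per_transport o o' (phi : int * int -> int * int) :
  (forall x y, phi (x - y) = phi x - phi y) ->
  (forall i z, walk o i i z -> exists j, walk o' j j (phi z)) ->
  forall z, Per o z -> Per o' (phi z).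
Proof.
move=> phiB h z; have [P0 PB] := subgroup_generated_subgroup [set z | exists i, walk o' i i z]%classic.
have phi0 : phi 0 = 0 by rewrite -[0 in LHS](subrr 0) phiB subrr.
apply: (subgroup_generated_min (H := [set z | Per o' (phi z)]%classic)).
  by split=> [|x y hx hy] /=; rewrite ?phi0 ?phiB //; apply: PB.
by move=> x [i /h hj]; apply: subgroup_generated_sub.
Qed.

Lemma walk_moveT o i j z : walk o i j z -> walk (moveT o) i j (z.1 + z.2, z.2).
Proof.
have e k : (moveT o).1 ((moveT o).2 k) = o.2 k by rewrite /= permM permKV.
elim=> {j z} [|j z _ IH|j z _ IH|j z _ IH|j z _ IH].
- exact: walk_nil.
- by have := walk_right IH; congr walk; congr (_, _) => /=; ring.
- by have := walk_left IH; congr walk; congr (_, _) => /=; ring.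
- by have := walk_right (walk_up IH); rewrite e; congr walk; congr (_, _) => /=; ring.
- rewrite -e in IH; have := walk_down (walk_left IH).
  by congr walk; congr (_, _) => /=; ring.
Qed.

Lemma walk_moveS o i j z : walk o i j z -> walk (moveS o) i j (- z.2, z.1).
Proof.
elim=> {j z} [|j z _ IH|j z _ IH|j z _ IH|j z _ IH].
- by have := walk_nil (moveS o) i; congr walk.
- by have := walk_up IH; congr walk; congr (_, _) => /=; ring.
- by have := walk_down IH; congr walk; congr (_, _) => /=; ring.
- have e : (moveS o).1 (o.2 j) = j by rewrite /= permK.
  rewrite -{1}e in IH; have := walk_left IH.
  by congr walk; congr (_, _) => /=; ring.
- have := walk_right IH; rewrite /= permK.
  by congr walk; congr (_, _) => /=; ring.
Qed.

Lemma walk_conj o s i j z : walk o i j z -> walk (conj_pair o s) (s i) (s j) z.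
Proof.
have e1 k : (conj_pair o s).1 (s k) = s (o.1 k) by rewrite /= permJ.
have e2 k : (conj_pair o s).2 (s k) = s (o.2 k) by rewrite /= permJ.
elim=> {j z} [|j z _ IH|j z _ IH|j z _ IH|j z _ IH].
- exact: walk_nil.
- by rewrite -e1; apply: walk_right.
- by apply: walk_left; rewrite e1.
- by rewrite -e2; apply: walk_up.
- by apply: walk_down; rewrite e2.
Qed.

Definition moved_by_two (k : {perm 'I_N}) : Prop :=
  exists p r, forall i, k i != i -> i \in [:: p; k p; r; k r].

Lemma moved_by_two_conj k s : moved_by_two k -> moved_by_two (k ^ s)%g.
Proof.
case=> p [r h]; exists (s p), (s r) => i.
rewrite -[i](permKV s); set j := (s^-1)%g i.
by rewrite !permJ (inj_eq perm_inj) => /h; rewrite !inE !(inj_eq perm_inj).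
Qed.

Record good (nu : nat) o : Prop := Good {
  good_connected : connected_pair o;
  good_corner : corner_inv o;
  good_moved : moved_by_two (corner o);
  good_Per : forall z, Per o (z *+ nu) }.

Lemma corner_inv_conj o o' s : corner o' = (corner o ^ s)%g -> corner_inv o -> corner_inv o'.
Proof. by rewrite /corner_inv => ->; rewrite -conjMg => ->; rewrite conj1g. Qed.

Lemma good_act nu A o o' : sl2z_act A o o' -> good nu o -> good nu o'.
Proof.
elim=> {A o o'} [o s|o|o|A B o o' o'' _ h1 _ h2 g]; last by apply: h2; apply: h1.
- case=> co ci cm cp.
  have ce : corner (conj_pair o s) = (corner o ^ s)%g by apply: corner_conj.
  split; rewrite ?ce.
  + move=> f f1 f2 i j.
    have := co (fun k => f (s k)) _ _ (s^-1%g i) (s^-1%g j); rewrite !permKV; apply=> k.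
      by have := f1 (s k); rewrite /= permJ.
    by have := f2 (s k); rewrite /= permJ.
  + exact: corner_inv_conj ce ci.
  + exact: moved_by_two_conj.
  + move=> z; apply: (Per_transport (phi := id) _ _ (cp z)) => // i x w.
    by exists (s i); apply: walk_conj.
- case=> co ci cm cp; have ce : corner (moveT o) = corner o.
    by rewrite /corner /moveT /= !normg.
  split; rewrite /corner_inv -/(moveT o) ?ce //.
  + move=> f f1 f2; apply: co => // i.
    by have := f2 i; rewrite /= permM -[in X in X -> _](f1 (o.1^-1%g _)) permKV.
  + move=> z; have := Per_transport (phi := fun x => (x.1 + x.2, x.2)) _ _ (cp (z.1 - z.2, z.2)).
    have -> : (((z.1 - z.2, z.2) : int * int) *+ nu).1 + (((z.1 - z.2, z.2) : int * int) *+ nu).2 = (z *+ nu).1.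
      by rewrite !raddfMn /= -mulrnDl subrK.
    have -> : (((z.1 - z.2, z.2) : int * int) *+ nu).2 = (z *+ nu).2 by rewrite !raddfMn.
    rewrite -surjective_pairing; apply; first by move=> x y; congr (_, _) => /=; ring.
    by move=> i x w; exists i; apply: walk_moveT.
- case=> co ci cm cp; have ce : corner (moveS o) = (corner o ^ o.2)%g.
    by rewrite /corner /moveS /conjg /= !normg.
  split; rewrite -/(moveS o) ?ce.
  + move=> f f1 f2; apply: co => // i.
    by have := f1 (o.2 i); rewrite /= permK.
  + exact: corner_inv_conj ce ci.
  + exact: moved_by_two_conj.
  + move=> z; have := Per_transport (phi := fun x => (- x.2, x.1)) _ _ (cp (z.2, - z.1)).
    have -> : - (((z.2, - z.1) : int * int) *+ nu).2 = (z *+ nu).1.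
      by rewrite !raddfMn /= ?mulNrn ?opprK.
    have -> : (((z.2, - z.1) : int * int) *+ nu).1 = (z *+ nu).2 by rewrite !raddfMn.
    rewrite -surjective_pairing; apply; first by move=> x y; congr (_, _) => /=; ring.
    by move=> i x w; exists i; apply: walk_moveS.
Qed.

End Walks.

(** * Cocycles dual to closed walks *)

Section DualCocycles.
Local Open Scope ring_scope.
Variables (N : nat) (o : sqpair N).

Definition vec2 (R : nzRingType) (x y : R) : 'rV[R]_(1 + 1) := row_mx x%:M y%:M.

Lemma vec2D (R : nzRingType) (x y x' y' : R) : vec2 x y + vec2 x' y' = vec2 (x + x') (y + y').
Proof. by rewrite /vec2 add_row_mx !raddfD. Qed.

Lemma vec2N (R : nzRingType) (x y : R) : - vec2 x y = vec2 (- x) (- y).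
Proof. by rewrite /vec2 opp_row_mx !raddfN. Qed.

Lemma vec2_0 (R : nzRingType) : vec2 0 0 = 0 :> 'rV[R]_(1 + 1).
Proof. by rewrite /vec2 !raddf0 row_mx0. Qed.

Lemma vec2E (R : nzRingType) (x y : R) : vec2 x y 0 0 = x /\ vec2 x y 0 1 = y.
Proof.
split.
  transitivity (vec2 x y 0 (lshift 1 0)); first by congr (vec2 _ _ _ _); apply: val_inj.
  by rewrite row_mxEl mxE.
transitivity (vec2 x y 0 (rshift 1 0)); first by congr (vec2 _ _ _ _); apply: val_inj.
by rewrite row_mxEr mxE.
Qed.

Let delta (i : 'I_N) : 'rV[int]_N := delta_mx 0 i.
Let E (i : 'I_N) : 'rV[int]_N := delta i *m (1%:M + permop int (corner o)).

Lemma delta_permop (p : {perm 'I_N}) i : delta (p i) *m permop int p = delta i.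
Proof. by apply/rowP=> k; rewrite permopE !mxE (inj_eq perm_inj). Qed.

Lemma delta_const i : delta i *m (const_mx 1 : 'cV_N) = 1%:M.
Proof.
apply/matrixP=> k l; rewrite !ord1 !mxE eqxx (bigD1 i) //= !mxE !eqxx mulr1.
by rewrite big1 ?addr0 // => j /negbTE ji; rewrite !mxE ji andbF mul0r.
Qed.

Hypothesis o_inv : corner_inv o.
Let K2 : permop int (corner o) *m permop int (corner o) = 1%:M.
Proof. by rewrite permopM o_inv permop1. Qed.

Lemma horizontal_edge j :
  (row_mx 0 (- delta (o.1 j)) *m closing int o = E (o.1 j) - E j) /\
  (row_mx 0 (- delta (o.1 j)) *m totals int N = vec2 0 (-1)).
Proof.
split; last first.
  by rewrite mul_row_block !(mul0mx, mulmx0, add0r) mulNmx delta_const /vec2 !raddf0 !raddfN.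
rewrite /closing mulmxA mul_row_col mul0mx add0r mulNmx mulmxBr delta_permop mulNmx.
rewrite mulmxBl -/(E j) opprB; congr (_ - _).
by rewrite /E -mulmxA !mulmxDr !mulmx1 K2 mulmx1 addrC.
Qed.

Lemma vertical_edge j :
  (row_mx (delta (o.2 j)) 0 *m closing int o = E (o.2 j) - E j) /\
  (row_mx (delta (o.2 j)) 0 *m totals int N = vec2 1 0).
Proof.
split; last first.
  by rewrite mul_row_block !(mul0mx, mulmx0, addr0) delta_const /vec2 !raddf0.
rewrite /closing mulmxA mul_row_col mul0mx addr0 mulmxBr mulmx1 mulmxBl -/(E _); congr (_ - _).
have -> : permop int (o.1 * o.2 * o.1^-1) = permop int o.2 *m permop int (corner o).
  by rewrite permopM /corner !normg.
rewrite (mulmxA (delta _)) delta_permop.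
by rewrite /E -mulmxA !mulmxDr !mulmx1 K2 mulmx1 addrC.
Qed.

(** Push each square of the walk to its top-right corner: a step right becomes the top
    edge of the next square and a step up its right edge.  The cochain counts the crossings
    with this path of edges, and it fails to close up only at the ends of the path. *)
Lemma walk_cocycle i j z : walk o i j z -> exists c : 'rV[int]_(N + N),
  c *m closing int o = E j - E i /\ c *m totals int N = vec2 z.2 (- z.1).
Proof.
elim=> {j z} [|j z _ [c [c1 c2]]|j z _ [c [c1 c2]]|j z _ [c [c1 c2]]|j z _ [c [c1 c2]]].
- by exists 0; rewrite !mul0mx subrr oppr0 vec2_0.
- have [e1 e2] := horizontal_edge j.
  exists (c + row_mx 0 (- delta (o.1 j))); rewrite !mulmxDl c1 c2 e1 e2 vec2D; split.
    by rewrite addrC addrA subrK.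
  by congr vec2; rewrite /=; ring.
- have [e1 e2] := horizontal_edge j.
  exists (c - row_mx 0 (- delta (o.1 j))); rewrite !mulmxBl c1 c2 e1 e2 vec2N vec2D; split.
    by rewrite opprB addrC addrA subrK.
  by congr vec2; rewrite /=; ring.
- have [e1 e2] := vertical_edge j.
  exists (c + row_mx (delta (o.2 j)) 0); rewrite !mulmxDl c1 c2 e1 e2 vec2D; split.
    by rewrite addrC addrA subrK.
  by congr vec2; rewrite /=; ring.
- have [e1 e2] := vertical_edge j.
  exists (c - row_mx (delta (o.2 j)) 0); rewrite !mulmxBl c1 c2 e1 e2 vec2N vec2D; split.
    by rewrite opprB addrC addrA subrK.
  by congr vec2; rewrite /=; ring.
Qed.

Lemma Per_cocycle z : Per o z -> exists c : 'rV[int]_(N + N),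
  c *m closing int o = 0 /\ c *m totals int N = vec2 z.2 (- z.1).
Proof.
apply: (subgroup_generated_min (H := [set z | exists c : 'rV[int]_(N + N),
  c *m closing int o = 0 /\ c *m totals int N = vec2 z.2 (- z.1)]%classic)).
  split=> [|x y [c [c1 c2]] [c' [c1' c2']]] /=.
    by exists 0; rewrite !mul0mx /= oppr0 vec2_0.
  exists (c - c'); rewrite !mulmxBl c1 c2 c1' c2' subrr vec2N vec2D; split=> //.
  by congr vec2; rewrite /=; ring.
by move=> x [i /walk_cocycle [c]]; rewrite subrr; exists c.
Qed.

End DualCocycles.

Section Evaluation.
Local Open Scope ring_scope.
Variables (N : nat) (o : sqpair N) (c : 'rV[int]_(N + N)) (x y : int) (g : 'rV[rat]_N).
Hypothesis c_eq : N%:R *: map_mx intr c =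
  map_mx intr (vec2 x y) *m consts rat N + g *m cobound rat o.

Let c_entries j :
  N%:R * (c 0 (lshift N j))%:~R = x%:~R + (g 0 (o.1 j) - g 0 j) /\
  N%:R * (c 0 (rshift N j))%:~R = y%:~R + (g 0 (o.2 j) - g 0 j) :> rat.
Proof.
have [e1 e2] := @consts_entries _ N (map_mx (intr : int -> rat) (vec2 x y)) j.
have [v1 v2] := vec2E x y.
have cE e : N%:R * (c 0 e)%:~R = (map_mx intr (vec2 x y) *m consts rat N) 0 e +
    (g *m cobound rat o) 0 e.
  have /rowP/(_ e) := c_eq; move: (_ *m consts rat N) (g *m _) => a b.
  by rewrite !mxE.
rewrite !cE e1 e2 ![map_mx _ _ _ _]mxE v1 v2 /cobound mul_mx_row row_mxEl row_mxEr.
by rewrite !mulmxBr !mulmx1; split; congr (_ + _); rewrite mxE permopE mxE.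
Qed.

Lemma walk_eval i j z : walk o i j z -> exists m : int,
  N%:R * m%:~R = x%:~R * z.1%:~R + y%:~R * z.2%:~R + (g 0 j - g 0 i) :> rat.
Proof.
elim=> {j z} [|j z _ [m em]|j z _ [m em]|j z _ [m em]|j z _ [m em]].
- by exists 0; rewrite /=; ring.
- exists (m + c 0 (lshift N j)); rewrite rmorphD mulrDr em (c_entries j).1 /= rmorphD; ring.
- exists (m - c 0 (lshift N j)); rewrite rmorphB mulrBr em (c_entries j).1 /= rmorphB; ring.
- exists (m + c 0 (rshift N j)); rewrite rmorphD mulrDr em (c_entries j).2 /= rmorphD; ring.
- exists (m - c 0 (rshift N j)); rewrite rmorphB mulrBr em (c_entries j).2 /= rmorphB; ring.
Qed.

(** Integrating the equation along a closed walk kills the coboundary, turns the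
    constants into the displacement, and gives an integer multiple of [N] on the left. *)
Lemma Per_eval z : Per o z -> exists m : int, N%:Z * m = x * z.1 + y * z.2.
Proof.
apply: (subgroup_generated_min (H := [set z | exists m : int, N%:Z * m = x * z.1 + y * z.2]%classic)).
  split=> [|u v [m em] [m' em']] /=; first by exists 0; rewrite /=; ring.
  by exists (m - m'); rewrite mulrBr em em' /=; ring.
move=> u [i /walk_eval[m em]]; exists m; apply: (@intr_inj rat).
by rewrite !(rmorphM, rmorphD) /= em subrr addr0.
Qed.

End Evaluation.

(** * Integral annihilating polynomials *)

Section IntegralAnnihilator.
Local Open Scope ring_scope.
Variables (n m : nat) (P : 'M[int]_n.+1) (y : 'rV[rat]_n.+1) (D : 'M[rat]_(m.+1, n.+1)).
Let MP : 'M[rat]_n.+1 := map_mx intr P.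
Hypothesis D_stable : stablemx D MP.
Hypothesis dep : exists2 al : 'rV[rat]_3, al != 0 &
  ((al 0 0 *: y + al 0 1 *: (y *m MP) + al 0 2%:R *: (y *m MP *m MP))%R <= D)%MS.

(** The annihilator of [y] modulo [D] contains a polynomial of degree at most 2 and, by
    Cayley-Hamilton, the characteristic polynomial of the integral matrix [P]; so it contains
    their greatest common divisor, which is integral and monic up to a scalar by the lemma
    of Gauss. *)
Lemma integral_annihilator : exists q : {poly int},
  [/\ q \is monic, (size q <= 3)%N,
      (y *m horner_mx MP (map_poly intr q) <= D)%MS &
      map_poly intr q %| char_poly MP].
Proof.
have [al al0 alD] := dep.
pose Q : {poly rat} := (al 0 0)%:P + al 0 1 *: 'X + al 0 2%:R *: 'X^2.
have QE : [/\ Q`_0 = al 0 0, Q`_1 = al 0 1 & Q`_2 = al 0 2%:R].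
  by rewrite /Q; split; rewrite !coefD !coefZ coefC coefX coefXn /=; ring.
have Q0 : Q != 0.
  apply: contra al0 => /eqP q0; move: QE; rewrite q0 !coef0 => -[e0 e1 e2].
  apply/eqP/rowP=> i; rewrite mxE.
  case: i => [] [|[|[|//]]] hi; [rewrite [RHS]e0|rewrite [RHS]e1|rewrite [RHS]e2];
    congr (al _ _); exact: val_inj.
have szQ : (size Q <= 3)%N.
  apply/leq_sizeP=> j; case: j => [|[|[|j]]] // _.
  by rewrite /Q !coefD !coefZ coefC coefX coefXn /=; ring.
have yQ : (y *m horner_mx MP Q <= D)%MS.
  rewrite /Q !raddfD /= !horner_mxZ horner_mx_C horner_mx_X rmorphXn /= horner_mx_X expr2.
  rewrite -!scalemxAr mul_mx_scalar -mulmxE mulmxA; exact: alD.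
have stab R : (y *m horner_mx MP Q *m horner_mx MP R <= D)%MS.
  apply: submx_trans (submxMr _ yQ) _; exact: horner_mx_stable.
pose p := char_poly MP.
have p0 : horner_mx MP p = 0 by apply: Cayley_Hamilton.
have [[u v] /= uv] := Bezoutp Q p.
have [q [a a0 gq] [r pqr]] : {p1 : {poly int} & {a | a != 0 & gcdp Q p = a *: map_poly intr p1} &
    {r | char_poly P = p1 * r}}.
  apply: dvdpP_rat_int; rewrite map_char_poly; exact: dvdp_gcdr.
have lc : lead_coef q * lead_coef r = 1.
  by rewrite -lead_coefM -pqr (monicP (char_poly_monic P)).
have lc2 : lead_coef q * lead_coef q = 1.
  have := congr1 absz lc; rewrite abszM => /eqP; rewrite muln_eq1 => /andP[/eqP l1 _].
  have [->|->] : lead_coef q = 1 \/ lead_coef q = -1 by lia.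
    by [].
  by [].
have lc0 : lead_coef q != 0 by apply: contra_eq_neq lc2 => ->; rewrite mul0r.
have [c c0 uvE] : exists2 c, c != 0 & map_poly intr (lead_coef q *: q) = c *: (u * Q + v * p).
  have : u * Q + v * p %= map_poly intr (lead_coef q *: q).
    apply: eqp_trans uv _; rewrite gq map_polyZ.
    apply: eqp_trans (eqp_scale _ a0) _; rewrite eqp_sym; apply: eqp_scale.
    by rewrite intr_eq0.
  by rewrite eqp_sym => /eqpf_eq[c c0 ->]; exists c.
exists (lead_coef q *: q); split.
- by rewrite monicE lead_coefZ lc2.
- rewrite size_scale //; apply: leq_trans szQ.
  have : gcdp Q p %| Q by apply: dvdp_gcdl.
  move/(dvdp_leq Q0); by rewrite gq size_scale // size_rat_int_poly.
- rewrite uvE horner_mxZ raddfD /= !rmorphM /= p0 mulr0 addr0.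
  rewrite -scalemxAr; apply: scalemx_sub.
  have -> : horner_mx MP u * horner_mx MP Q = horner_mx MP Q *m horner_mx MP u.
    by rewrite mulmxE -!rmorphM mulrC.
  by rewrite mulmxA.
- rewrite map_polyZ dvdpZl ?intr_eq0 //.
  have : gcdp Q p %| p by apply: dvdp_gcdr.
  by rewrite gq dvdpZl.
Qed.

End IntegralAnnihilator.

Section RootBound.
Local Open Scope ring_scope.
Variables (n k : nat) (P : 'M[int]_n.+1) (q : {poly int}) (M : 'M[int]_k.+1) (S : algC).
Hypothesis q_monic : q \is monic.
Hypothesis q_size : (size q <= 3)%N.
Hypothesis q_dvd : map_poly (intr : int -> rat) q %| char_poly (map_mx intr P).
Hypothesis eigen_le : forall mu, eigenvalue (map_mx (intr : int -> algC) P) mu -> `|mu| <= S.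
Hypothesis S_ge1 : 1 <= S.

Definition ell1 (v : 'rV[algC]_k.+1) : algC := \sum_i `|v 0 i|.

Hypothesis M_le : forall v : 'rV[algC]_k.+1, ell1 (v *m map_mx intr M) <= S * ell1 v.

(** Over the algebraic numbers [q] is a product of at most two factors X - mu, where mu is
    an eigenvalue of [P]. *)
Lemma ell1_horner (v : 'rV[algC]_k.+1) :
  ell1 (v *m horner_mx (map_mx intr M) (map_poly intr q)) <= (2 * S) ^+ 2 * ell1 v.
Proof.
pose qC := map_poly (intr : int -> algC) q.
have mqC : qC \is monic by apply: monic_map.
have [rs qE] := closed_field_poly_normal qC.
rewrite (monicP mqC) scale1r in qE.
have S0 : 0 <= S by apply: le_trans S_ge1.
have ell1_ge0 u : 0 <= ell1 u by apply: sumr_ge0.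
have szrs : (size rs <= 2)%N.
  have := size_prod_XsubC rs id; rewrite -qE size_map_inj_poly //; last exact: intr_inj.
  by move=> e; move: q_size; rewrite e ltnS.
have rsS mu : mu \in rs -> `|mu| <= S.
  move=> mrs; apply: eigen_le; rewrite eigenvalue_root_char.
  have : root qC mu by rewrite qE root_prod_XsubC.
  have : qC %| char_poly (map_mx (intr : int -> algC) P).
    have -> : qC = map_poly ratr (map_poly (intr : int -> rat) q).
      by rewrite -map_poly_comp; apply: eq_map_poly => x /=; rewrite ratr_int.
    have -> : map_mx (intr : int -> algC) P = map_mx ratr (map_mx (intr : int -> rat) P).
      by rewrite -map_mx_comp; apply: eq_map_mx => x /=; rewrite ratr_int.
    by rewrite -(map_char_poly (@ratr algC)) dvdp_map.
  by move=> d; rewrite -!dvdp_XsubCl => /dvdp_trans; apply.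
rewrite -/qC qE.
have bound u mu : `|mu| <= S -> ell1 (u *m (map_mx intr M - mu%:M)) <= 2 * S * ell1 u.
  move=> muS; rewrite mulmxBr mul_mx_scalar.
  apply: (@le_trans _ _ (ell1 (u *m map_mx intr M) + ell1 (mu *: u))).
    by rewrite /ell1 -big_split /=; apply: ler_sum => i _; rewrite !mxE ler_normB.
  rewrite -mulrA mulr_natl mulr2n lerD //.
  have -> : ell1 (mu *: u) = `|mu| * ell1 u.
    by rewrite /ell1 mulr_sumr; apply: eq_bigr => i _; rewrite !mxE normrM.
  by rewrite ler_wpM2r.
have : forall u, ell1 (u *m horner_mx (map_mx intr M) (\prod_(z <- rs) ('X - z%:P)))
    <= (2 * S) ^+ (size rs) * ell1 u.
  elim: rs rsS {qE szrs} => [|mu rs IH] rsS u.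
    by rewrite big_nil rmorph1 mulmx1 expr0 mul1r.
  rewrite big_cons rmorphM /= raddfB /= horner_mx_X horner_mx_C -mulmxE mulmxA.
  apply: le_trans (IH _ _) _; first by move=> x xrs; apply: rsS; rewrite inE xrs orbT.
  rewrite exprSr -mulrA ler_wpM2l ?exprn_ge0 ?mulr_ge0 //.
  by apply: bound; apply: rsS; rewrite inE eqxx.
move/(_ v)/le_trans; apply; rewrite ler_wpM2r // ler_weXn2l //.
by apply: le_trans S_ge1 _; apply: ler_peMl => //; rewrite ler1n.
Qed.

End RootBound.

(** * A hyperbolic element bounds the number of squares *)

Section LinWord.
Local Open Scope ring_scope.

Lemma lin_letter_mx2 x : lin_letter int x = if x then mx2 1 1 0 1 else mx2 1 0 1 1.
Proof.
case: x; apply/matrixP=> i j; rewrite /lin_letter;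
  case: (split_ordP i) => k ->; case: (split_ordP j) => l ->;
  by rewrite ?(block_mxEul, block_mxEur, block_mxEdl, block_mxEdr) !ord1 !mxE.
Qed.

Lemma lin_word_mx2 w : exists a b c d : int,
  [/\ lin_word int w = mx2 a b c d, mat_word w = mx2 d (- b) (- c) a,
      [/\ 0 <= a, 0 <= b, 0 <= c & 0 <= d], a * d - b * c = 1 &
      (true \notin w -> b = 0) /\ (false \notin w -> c = 0)].
Proof.
elim: w => [|x w [a [b [c [d [e1 e2 [a0 b0 c0 d0] det [wt wf]]]]]]].
  by exists 1, 0, 0, 1; rewrite /= -one_mx2 oppr0; split=> //; rewrite one_mx2.
rewrite /= e1 e2 lin_letter_mx2 /mat_letter /mxTk /mxLk.
case: x; rewrite !mul_mx2.
  exists a, (a + b), c, (c + d); split.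
  - by congr mx2; ring.
  - by congr mx2; ring.
  - by split; rewrite ?addr_ge0.
  - by rewrite -det; ring.
  - by rewrite !inE.
exists (a + b), b, (c + d), d; split.
- by congr mx2; ring.
- by congr mx2; ring.
- by split; rewrite ?addr_ge0.
- by rewrite -det; ring.
- by rewrite !inE /=; split.
Qed.

Lemma row_mul_mx2 (R : comNzRingType) (u : 'rV[R]_(1 + 1)) (a b c d : int) :
  (u *m map_mx intr (mx2 a b c d)) 0 0 = u 0 0 * a%:~R + u 0 1 * c%:~R /\
  (u *m map_mx intr (mx2 a b c d)) 0 1 = u 0 0 * b%:~R + u 0 1 * d%:~R.
Proof.
have e : lift ord0 ord0 = 1 :> 'I_(1 + 1) by apply: val_inj.
by split; rewrite mxE big_ord_recl big_ord1 e !mxE.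
Qed.

Lemma row_mul_col3 (R : comNzRingType) k (al : 'rV[R]_(1 + (1 + 1))) (A B C : 'rV[R]_k) :
  al *m col_mx A (col_mx B C) = al 0 0 *: A + al 0 1 *: B + al 0 2%:R *: C.
Proof.
rewrite -{1}[al]hsubmxK mul_row_col -{1}[rsubmx al]hsubmxK mul_row_col addrA.
rewrite [lsubmx al]mx11_scalar [lsubmx (rsubmx al)]mx11_scalar [rsubmx (rsubmx al)]mx11_scalar.
rewrite !mul_scalar_mx !mxE.
by congr (_ *: A + _ *: B + _ *: C); congr (al _ _); apply: val_inj.
Qed.

Lemma gt0_of_mul_add (F : realFieldType) (x y : F) : 0 < x * y -> 0 < x + y -> 0 < x.
Proof.
move=> xy xDy; rewrite ltNge; apply/negP=> x0.
have [y0|y0] := lerP y 0; first by lra.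
by move: xy; rewrite ltNge mulr_le0_ge0 // ltW.
Qed.

(** Numerator and denominator of a rational root would divide each other's squares, so
    the root would be 1 or -1. *)
Lemma hyperbolic_irrational (t : int) (rho : rat) : 3 <= t ->
  rho ^+ 2 - t%:~R * rho + 1 != 0.
Proof.
move=> t3; apply/eqP; rewrite -[rho]divq_num_den.
have := coprime_num_den rho; have := denq_gt0 rho.
move: (numq rho) (denq rho) => n m m0 cop.
have mn0 : m%:~R != 0 :> rat by rewrite intr_eq0 gt_eqF.
move=> /(congr1 (fun x => x * m%:~R ^+ 2)).
rewrite mul0r => e.
have {}e : n ^+ 2 - t * (n * m) + m ^+ 2 = 0.
  apply: (@intr_inj rat); rewrite !(rmorphD, rmorphB, rmorphXn, rmorphM) /= -[RHS]e.
  by field.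
have n1 : `|n|%N = 1%N.
  have : (n %| m ^+ 2)%Z.
    apply/dvdzP; exists (t * m - n).
    transitivity (m ^+ 2 - (n ^+ 2 - t * (n * m) + m ^+ 2)); last by ring.
    by rewrite e subr0.
  rewrite dvdzE abszX => dv; apply/eqP; rewrite -dvdn1 -(eqP (coprimeXr 2 cop)).
  by rewrite dvdn_gcd dvdnn.
have m1 : m = 1.
  have : (m %| n ^+ 2)%Z.
    apply/dvdzP; exists (t * n - m).
    transitivity (n ^+ 2 - (n ^+ 2 - t * (n * m) + m ^+ 2)); last by ring.
    by rewrite e subr0.
  rewrite dvdzE abszX => dv.
  have : `|m|%N = 1%N.
    apply/eqP; rewrite -dvdn1 -(eqP (coprimeXl 2 cop)).
    by rewrite dvdn_gcd dvdnn andbT.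
  lia.
have nn : n = 1 \/ n = -1 by lia.
by move: e; rewrite m1; case: nn => ->; lia.
Qed.

End LinWord.

Section KeyBound.
Local Open Scope ring_scope.
Variables (N' : nat).
Let N := N'.+1.
Variables (o : sqpair N) (w : seq bool) (s : {perm 'I_N}) (nu : nat).
Hypothesis nu_gt0 : (0 < nu)%N.
Hypothesis o_good : good nu o.
Hypothesis ow : word w o = conj_pair o s.
Variables a b c d : int.
Hypothesis linE : lin_word int w = mx2 a b c d.
Hypotheses (a_ge0 : 0 <= a) (b_gt0 : 0 < b) (c_gt0 : 0 < c) (d_ge0 : 0 <= d).
Hypothesis detE : a * d - b * c = 1.
Hypothesis tr_ge3 : 3 <= a + d.
Hypotheses (tw : true \in w) (fw : false \in w).

Let n := (N' + N)%N.
(** The action on cochains of the affine map that fixes [o] up to the relabelling [s]. *)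
Definition pullZ : 'M[int]_(N + N) := pull int w o *m relabel int s.
Notation pullR R := (map_mx (intr : int -> R) pullZ).

Lemma pullRE (R : comNzRingType) : pullR R = pull R w o *m relabel R s.
Proof. by rewrite /pullZ map_mxM map_pull map_relabel. Qed.

Lemma cobound_pullR (R : comNzRingType) : cobound R o *m pullR R = permop R s *m cobound R o.
Proof. by rewrite pullRE mulmxA cobound_pull ow cobound_relabel. Qed.

Lemma pullR_totals (R : comNzRingType) : pullR R *m totals R N = totals R N *m lin_word R w.
Proof. by rewrite pullRE -mulmxA relabel_total pull_total. Qed.

Lemma consts_pullR (R : comNzRingType) : consts R N *m pullR R = lin_word R w *m consts R N.
Proof. by rewrite pullRE mulmxA consts_pull -mulmxA consts_relabel. Qed.

Lemma pullR_closing (R : comNzRingType) :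
  exists Y, pullR R *m closing R o = closing R o *m Y.
Proof.
have [Y e] := pull_closing R w (good_corner o_good).
exists (Y *m permop R s).
by rewrite pullRE -mulmxA relabel_closing -ow mulmxA e mulmxA.
Qed.

(** For an eigenvector x, the entries |x| satisfy |mu| |x| <= |x| P since P is
    non-negative.  Taking totals turns P into the two by two matrix of the word. *)
Lemma eigen_bound (mu : algC) : eigenvalue (pullR algC) mu -> `|mu| <= (a + b + c + d)%:~R.
Proof.
case/eigenvalueP => x ex x0.
pose y : 'rV[algC]_(N + N) := \row_e `|x 0 e|.
have le_step z z' x' o' : (forall e, `|(z : 'rV[algC]_(N + N)) 0 e| <= (z' : 'rV[algC]_(N + N)) 0 e) ->
    forall e, `|(z *m step algC x' o') 0 e| <= (z' *m step algC x' o') 0 e.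
  move=> h e; case: (split_ordP e) => i ->;
    have [e1 e2] := step_entries x' o' z i; have [e3 e4] := step_entries x' o' z' i;
    rewrite ?e1 ?e2 ?e3 ?e4; case: x' {e1 e2 e3 e4} => //;
    by apply: le_trans (ler_normD _ _) _; rewrite lerD.
have le_pull w' : forall e, `|(x *m pull algC w' o) 0 e| <= (y *m pull algC w' o) 0 e.
  elim: w' => [|x' w' IH] /= e; first by rewrite !mulmx1 mxE.
  by rewrite !mulmxA; apply: le_step.
have le_mu e : `|mu| * y 0 e <= (y *m pullR algC) 0 e.
  have -> : `|mu| * y 0 e = `|(mu *: x) 0 e| by rewrite !mxE normrM.
  rewrite -ex pullRE !mulmxA.
  case: (split_ordP e) => i ->;
    have [e1 e2] := relabel_entries s (x *m pull algC w o) i;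
    have [e3 e4] := relabel_entries s (y *m pull algC w o) i; rewrite ?e1 ?e2 ?e3 ?e4; apply: le_pull.
pose u := y *m totals algC N.
have uE : u *m lin_word algC w = (y *m pullR algC) *m totals algC N.
  by rewrite /u -mulmxA -pullR_totals mulmxA.
have tot z k : ((z : 'rV[algC]_(N+N)) *m totals algC N) 0 k =
   \sum_i z 0 (if k == 0 then lshift N i else rshift N i).
  rewrite -{1}[z]hsubmxK /totals mul_row_block !(mulmx0, addr0, add0r).
  case: (split_ordP k) => j -> ; rewrite ?(row_mxEl, row_mxEr) !ord1 mxE.
    by apply: eq_bigr => i _; rewrite !mxE mulr1.
  by apply: eq_bigr => i _; rewrite !mxE mulr1.
have u_ge0 k : 0 <= u 0 k by rewrite tot sumr_ge0 // => i _; rewrite mxE normr_ge0.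
have le_u k : `|mu| * u 0 k <= (u *m lin_word algC w) 0 k.
  rewrite uE !tot mulr_sumr; apply: ler_sum => i _; exact: le_mu.
have linC : lin_word algC w = map_mx intr (mx2 a b c d).
  by rewrite -linE map_lin_word.
have [e0 e1] := row_mul_mx2 u a b c d.
have := le_u 0; have := le_u 1; rewrite linC e0 e1 => l1 l0.
have u_pos : 0 < u 0 0 + u 0 1.
  rewrite lt0r addr_ge0 // andbT; apply: contra x0.
  rewrite paddr_eq0 // => /andP[u0 u1]; apply/eqP/rowP=> e; rewrite [RHS]mxE; apply/eqP.
  rewrite -normr_eq0; move: u0 u1; rewrite !tot !psumr_eq0 /=; try by move=> *; rewrite mxE normr_ge0.
  move=> /allP h0 /allP h1; case: (split_ordP e) => i ->.
    by have := h0 i (mem_index_enum _); rewrite mxE.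
  by have := h1 i (mem_index_enum _); rewrite mxE.
have aC : 0 <= a%:~R :> algC by rewrite ler0z.
have bC : 0 <= b%:~R :> algC by rewrite ler0z ltW.
have cC : 0 <= c%:~R :> algC by rewrite ler0z ltW.
have dC : 0 <= d%:~R :> algC by rewrite ler0z.
rewrite -(ler_pM2r u_pos) mulrDr; apply: le_trans (lerD l0 l1) _.
rewrite !rmorphD /= -subr_ge0.
set X := (X in 0 <= X).
have -> : X = u 0 0 * (c%:~R + d%:~R) + u 0 1 * (a%:~R + b%:~R) by rewrite /X; ring.
by rewrite addr_ge0 // mulr_ge0 // addr_ge0.
Qed.

Lemma lin_word_norm1 (v : 'rV[algC]_2) :
  ell1 (v *m map_mx intr (lin_word int w : 'M_2)) <= (a + b + c + d)%:~R * ell1 v.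
Proof.
have [e0 e1] := row_mul_mx2 v a b c d.
have n1 (u : 'rV[algC]_2) : ell1 u = `|u 0 0| + `|u 0 1|.
  rewrite /ell1 big_ord_recl big_ord1; congr (_ + `|u _ _|); exact: val_inj.
rewrite linE !n1 e0 e1.
have aC : 0 <= a%:~R :> algC by rewrite ler0z.
have bC : 0 <= b%:~R :> algC by rewrite ler0z ltW.
have cC : 0 <= c%:~R :> algC by rewrite ler0z ltW.
have dC : 0 <= d%:~R :> algC by rewrite ler0z.
apply: le_trans (lerD (ler_normD _ _) (ler_normD _ _)) _.
rewrite !normrM (ger0_norm aC) (ger0_norm bC) (ger0_norm cC) (ger0_norm dC) !rmorphD /=.
rewrite -subr_ge0; set X := (X in 0 <= X).
have -> : X = `|v 0 0| * (c%:~R + d%:~R) + `|v 0 1| * (a%:~R + b%:~R) by rewrite /X; ring.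
by rewrite addr_ge0 // mulr_ge0 // addr_ge0.
Qed.

(** If lam > 1 and mu = lam^-1 are the roots of X^2 - (a + d) X + 1, then y P - mu y is an
    eigenclass for lam.  It lifts to an eigencochain, because the permutation [s] has no
    eigenvalue lam on functions, and this eigencochain is zero by [perron_frobenius].  So y is
    an eigenclass for mu; but y and P are rational and mu is not. *)
Lemma sub_cobound_of_quadratic_in (F : rcfType) (y : 'rV[rat]_(N + N)) : y *m totals rat N = 0 ->
  ((y *m pullR rat *m pullR rat - (a + d)%:~R *: (y *m pullR rat) + y)%R
     <= cobound rat o)%MS -> (y <= cobound rat o)%MS.
Proof.
move=> ty /submxP[g eg].
pose t : F := (a + d)%:~R.
have t3 : 3 <= t by have := tr_ge3; rewrite -(ler_int F).
have disc : 0 < t ^+ 2 - 4 by nra.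
pose r := Num.sqrt (t ^+ 2 - 4).
have r0 : 0 < r by rewrite sqrtr_gt0.
have r2 : r ^+ 2 = t ^+ 2 - 4 by rewrite sqr_sqrtr // ltW.
pose lam := (t + r) / 2; pose mu := (t - r) / 2.
have lm : lam * mu = 1.
  rewrite /lam /mu; have -> : (t + r) / 2 * ((t - r) / 2) = (t ^+ 2 - r ^+ 2) / 4 by field.
  by rewrite r2; field.
have lpm : lam + mu = t by rewrite /lam /mu; field.
have lam1 : 1 < lam by rewrite /lam; lra.
have mapD : map_mx ratr (cobound rat o) = cobound F o.
  rewrite -(map_cobound rat) -(map_cobound F) -map_mx_comp.
  by apply: eq_map_mx => x /=; rewrite ratr_int.
have mapP : map_mx ratr (pullR rat) = pullR F.
  by rewrite -map_mx_comp; apply: eq_map_mx => x /=; rewrite ratr_int.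
have mapT : map_mx ratr (totals rat N) = totals F N.
  rewrite -(map_total rat) -(map_total F) -map_mx_comp.
  by apply: eq_map_mx => x /=; rewrite ratr_int.
have mapyP (z : 'rV[rat]_(N + N)) : map_mx (@ratr F) (z *m pullR rat) =
    map_mx ratr z *m pullR F by rewrite -[in RHS]mapP; apply: map_mxM.
have mapgD (z : 'rV[rat]_N) : map_mx (@ratr F) (z *m cobound rat o) =
    map_mx ratr z *m cobound F o by rewrite -[in RHS]mapD; apply: map_mxM.
have mapZ (z : 'rV[rat]_(N + N)) (B : 'M_(N + N)) : map_mx (@ratr F) (z *m B) =
    map_mx ratr z *m map_mx ratr B by apply: map_mxM.
pose yR : 'rV[F]_(N + N) := map_mx ratr y; pose gR : 'rV[F]_N := map_mx ratr g.
have egR : yR *m pullR F *m pullR F - t *: (yR *m pullR F) + yR = gR *m cobound F o.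
  have := congr1 (map_mx (@ratr F)) eg.
  by rewrite map_mxD map_mxB map_mxZ !mapyP mapgD /= ratr_int.
have tyR : yR *m totals F N = 0.
  by rewrite -mapT -map_mxM ty map_mx0.
pose y1 := yR *m pullR F - mu *: yR.
have ey1 : y1 *m pullR F = lam *: y1 + gR *m cobound F o.
  rewrite -egR /y1 mulmxBl -scalemxAl scalerBr scalerA lm scale1r -lpm scalerDl.
  by apply/rowP=> i; rewrite !mxE; ring.
(* If [s] has order k, an eigenvector z for [lam] satisfies z = lam^k z. *)
have unitX : lam%:M - permop F s \in unitmx.
  rewrite -row_free_unit -kermx_eq0; apply/eqP/row_matrixP=> i; rewrite row0.
  set z := row i _; have ez : z *m permop F s = lam *: z.
    have : z *m (lam%:M - permop F s) = 0 by rewrite -row_mul mulmx_ker row0.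
    by rewrite mulmxBr mul_mx_scalar => /subr0_eq.
  have eX k : z = lam ^+ k *: z -> (0 < k)%N -> z = 0.
    move=> e k0; apply/eqP; have : (1 - lam ^+ k) *: z = 0 by rewrite scalerBl scale1r -e subrr.
    move/eqP; rewrite scaler_eq0 subr_eq0 eq_sym => /orP[|//].
    by rewrite gt_eqF // exprn_egt1 // -lt0n.
  apply: (eX #[s]%g); last exact: order_gt0.
  have it k : z *m permop F (s ^+ k)%g = lam ^+ k *: z.
    elim: k => [|k IH]; first by rewrite expg0 permop1 mulmx1 expr0 scale1r.
    by rewrite expgS -permopM mulmxA IH -scalemxAl ez scalerA exprSr.
  by rewrite -it expg_order permop1 mulmx1.
pose u := gR *m invmx (lam%:M - permop F s).
have eu : u *m permop F s = lam *: u - gR.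
  have : u *m (lam%:M - permop F s) = gR by rewrite mulmxKV.
  by rewrite mulmxBr mul_mx_scalar => <-; rewrite opprB addrC subrK.
pose y2 := y1 + u *m cobound F o.
have ey2 : y2 *m pullR F = lam *: y2.
  rewrite /y2 mulmxDl ey1 -(mulmxA u) cobound_pullR mulmxA eu mulmxBl scalerDr -scalemxAl.
  by apply/rowP=> i; rewrite !mxE; ring.
have ty1 : y1 *m totals F N = 0.
  by rewrite /y1 mulmxBl -scalemxAl -mulmxA pullR_totals mulmxA tyR mul0mx scaler0 subr0.
have y20 : y2 = 0.
  pose u0 : 'rV[F]_(1 + 1) := vec2 c%:~R (lam - a%:~R).
  have [u00 u01] := vec2E (c%:~R : F) (lam - a%:~R).
  have detF : a%:~R * d%:~R - b%:~R * c%:~R = 1 :> F.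
    by rewrite -!rmorphM -rmorphB detE.
  have cF : 0 < c%:~R :> F by rewrite ltr0z.
  have bF : 0 < b%:~R :> F by rewrite ltr0z.
  have tE : t = a%:~R + d%:~R by rewrite /t rmorphD.
  have lamE : lam * lam = lam * t - 1 by rewrite -lpm -lm; ring.
  apply: (perron_frobenius (lam := lam) (u0 := u0) _ (good_connected o_good) ow tw fw) => //.
  - by apply: lt_trans lam1.
  - by rewrite u00.
  - rewrite u01; have h1 : (lam - a%:~R) * (lam - d%:~R) = b%:~R * c%:~R.
      transitivity (lam * lam - lam * t + a%:~R * d%:~R); first by rewrite tE; ring.
      have bcE : b%:~R * c%:~R = a%:~R * d%:~R - 1 :> F by rewrite -[X in _ - X]detF opprB addrC subrK.
      by rewrite lamE bcE; ring.
    have h2 : (lam - a%:~R) + (lam - d%:~R) = r by rewrite /lam tE; field.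
    by apply: (gt0_of_mul_add (y := lam - d%:~R)); rewrite ?h1 ?h2 // mulr_gt0.
  - have [e0 e1] := row_mul_mx2 u0 a b c d.
    rewrite -map_lin_word linE; apply/rowP=> k.
    case: (split_ordP k) => j ->; rewrite !ord1.
      transitivity ((u0 *m map_mx intr (mx2 a b c d)) 0 0); first by congr (_ _ _); apply: val_inj.
      transitivity ((lam *: u0) 0 0); last by congr (_ _ _); apply: val_inj.
      by rewrite e0 u00 u01 [RHS]mxE u00; ring.
    transitivity ((u0 *m map_mx intr (mx2 a b c d)) 0 1); first by congr (_ _ _); apply: val_inj.
    transitivity ((lam *: u0) 0 1); last by congr (_ _ _); apply: val_inj.
    rewrite e1 u00 u01 [RHS]mxE u01 mulrBr lamE tE.
    transitivity (lam * d%:~R - (a%:~R * d%:~R - b%:~R * c%:~R)); first by ring.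
    by rewrite detF; ring.
  - by rewrite -mulmxA -pullRE.
  - by rewrite mulmxDl ty1 -mulmxA cobound_total mulmx0 addr0.
have ey1D : y1 = - u *m cobound F o.
  by apply/eqP; rewrite mulNmx -addr_eq0 -/y2 y20.
pose Z := cokermx (cobound rat o).
have y1Z : y1 *m map_mx ratr Z = 0.
  by rewrite ey1D -mulmxA -mapD -map_mxM mulmx_coker map_mx0 mulmx0.
rewrite submxE -/Z; apply/eqP/rowP=> k; rewrite [RHS]mxE.
have : ratr ((y *m pullR rat *m Z) 0 k) - mu * ratr ((y *m Z) 0 k) = 0 :> F.
  have := congr1 (fun M : 'rV_(N + N) => M 0 k) y1Z.
  rewrite /y1 mulmxBl -scalemxAl /yR -mapyP -!mapZ.
  by move: (_ *m Z) (y *m Z) => A B; rewrite !mxE.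
move: ((y *m pullR rat *m Z) 0 k) ((y *m Z) 0 k) => p q e; apply/eqP/negPn/negP=> q0.
have qF : ratr q != 0 :> F by rewrite fmorph_eq0.
have muE : mu = ratr (p / q).
  by rewrite fmorph_div; apply: (mulIf qF); rewrite divfK //; apply/eqP; rewrite eq_sym -subr_eq0 e.
move: (p / q) muE => rho muE.
have /eqP := hyperbolic_irrational rho tr_ge3; apply.
apply: (fmorph_inj (@ratr F)); rewrite rmorph0 rmorphD rmorphB rmorphXn rmorphM /=.
rewrite -muE ratr_int -/t rmorph1 -lpm -[X in _ + X]lm; ring.
Qed.

Let M : 'M[int]_2 := lin_word int w.
Let P : 'M[int]_n.+1 := pullZ.
Let S : int := a + b + c + d.
Let v : 'rV[int]_2 := vec2 nu%:Z 0.
Let PR (R : comNzRingType) : 'M[R]_n.+1 := map_mx intr P.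

Lemma consts_horner (q : {poly int}) :
  (consts int N : 'M_(2, n.+1)) *m horner_mx P q = horner_mx M q *m consts int N.
Proof.
have cP : (consts int N : 'M_(2, n.+1)) *m P = M *m consts int N.
  have := consts_pullR int; rewrite -[X in _ *m X = _](_ : P = _) //.
  by rewrite map_mx_id_in // => i j; rewrite intz.
elim/poly_ind: q => [|q e IH]; first by rewrite !rmorph0 mulmx0 mul0mx.
rewrite !rmorphD !rmorphM /= !horner_mx_X !horner_mx_C -!mulmxE mulmxDr mulmxDl !mulmxA IH.
by rewrite -!mulmxA cP mul_mx_scalar mul_scalar_mx.
Qed.

(** If q(M) killed [v], so would the remainder of q(M) by the characteristic polynomial,
    which has degree at most 1 in M; but [v] and [v *m M] are linearly independent, because
    [b] is not zero. *)
Lemma v_horner_neq0 (q : {poly int}) : q \is monic -> (size q <= 3)%N ->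
  q != char_poly M -> v *m horner_mx M q != 0.
Proof.
move=> mq sq qM; apply/eqP=> vq.
have mM : char_poly M \is monic by apply: char_poly_monic.
have sM : size (char_poly M) = 3%N by apply: size_char_poly.
pose r := q - q`_2 *: char_poly M.
have sr : (size r <= 2)%N.
  apply/leq_sizeP=> j; rewrite leq_eqVlt => /orP[/eqP <-|j2].
    have lM : (char_poly M)`_2 = 1 by have := monicP mM; rewrite lead_coefE sM.
    by rewrite /r coefB coefZ lM mulr1 subrr.
  have qj : q`_j = 0 by rewrite nth_default // (leq_trans sq).
  have Mj : (char_poly M)`_j = 0 by rewrite nth_default // sM.
  by rewrite /r coefB coefZ qj Mj mulr0 subr0.
have vr : v *m horner_mx M r = 0.
  by rewrite raddfB /= horner_mxZ Cayley_Hamilton scaler0 subr0.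
have rE : r = (r`_0)%:P + r`_1 *: 'X.
  apply/polyP=> -[|[|j]]; rewrite coefD coefC coefZ coefX /= ?mulr0 ?mulr1 ?addr0 ?add0r //.
  by rewrite nth_default // (leq_trans sr).
have [v0 v1] := vec2E nu%:Z (0 : int).
have [e0 e1] := row_mul_mx2 v a b c d.
have nu0 : nu%:Z != 0 by rewrite eqz_nat -lt0n.
have vM : v *m horner_mx M r = r`_0 *: v + r`_1 *: (v *m map_mx intr (mx2 a b c d)).
  rewrite {1}rE raddfD /= horner_mxZ horner_mx_C horner_mx_X mulmxDr mul_mx_scalar -scalemxAr.
  by rewrite -linE map_lin_word.
have r1 : r`_1 = 0.
  have := congr1 (fun A : 'rV_2 => A 0 1) vM; rewrite vr mxE [RHS]mxE [X in _ = X + _]mxE.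
  rewrite [X in _ = _ + X]mxE e1 v0 v1 !intz mul0r mulr0 add0r addr0 => /esym/eqP.
  by rewrite !mulf_eq0 (negbTE nu0) (gt_eqF b_gt0) !orbF => /eqP.
have r0 : r`_0 = 0.
  have := congr1 (fun A : 'rV_2 => A 0 0) vM; rewrite vr r1 scale0r addr0 [LHS]mxE [RHS]mxE v0 => /esym/eqP.
  by rewrite mulf_eq0 (negbTE nu0) orbF => /eqP.
have /subr0_eq qE : r = 0 by rewrite rE r0 r1 scale0r addr0.
case/eqP: qM; have l := monicP mq.
have : lead_coef q = q`_2 by rewrite {1}qE lead_coefZ (monicP mM) mulr1.
by rewrite l => e; rewrite qE -e scale1r.
Qed.

Lemma char_poly_lin : char_poly M = 'X^2 - (a + d) *: 'X + 1%:P.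
Proof.
have e (i : 'I_2) : i = 0 \/ i = 1 by case: i => [] [|[|//]] hi; [left|right]; apply: val_inj.
rewrite /char_poly /M linE (expand_det_row _ 0) big_ord_recl big_ord1 /cofactor !det_mx11 !mxE /=.
rewrite expr0 expr1 -mul_polyC -detE !rmorphB !rmorphD !rmorphM /= /bump /=; ring.
Qed.

(** When [y] is a coboundary, q = 1 will do.  Otherwise
    [sub_cobound_of_quadratic_in] excludes the characteristic polynomial of [M]. *)
Lemma exists_annihilator (y : 'rV[int]_(N + N)) :
  y *m closing int o = 0 -> y *m totals int N = 0 ->
  exists q : {poly int}, [/\ q \is monic, (size q <= 3)%N, q != char_poly M,
    (map_mx intr (y : 'rV_n.+1) *m horner_mx (PR rat) (map_poly intr q) <= cobound rat o)%MS &
    map_poly intr q %| char_poly (PR rat)].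
Proof.
move=> yC yT; pose yQ : 'rV[rat]_(N + N) := map_mx intr y.
have [yD|yD] := boolP (yQ <= cobound rat o)%MS.
  exists 1; split.
  - exact: monic1.
  - by rewrite size_poly1.
  - by apply/eqP=> e; have := size_char_poly M; rewrite -e size_poly1.
  - by rewrite !rmorph1 mulmx1.
  - by rewrite rmorph1 dvd1p.
have N0 : (0 < N)%N by [].
have [p [r moved]] := good_moved o_good.
have yQC : yQ *m closing rat o = 0 by rewrite -map_closing -map_mxM yC map_mx0.
have yQT : yQ *m totals rat N = 0 by rewrite -map_total -map_mxM yT map_mx0.
have stC (z : 'rV_(N + N)) : z *m closing rat o = 0 -> z *m pullR rat *m closing rat o = 0.
  by move=> zC; have [Y e] := pullR_closing rat; rewrite -mulmxA e mulmxA zC mul0mx.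
have stT (z : 'rV_(N + N)) : z *m totals rat N = 0 -> z *m pullR rat *m totals rat N = 0.
  by move=> zT; rewrite -mulmxA pullR_totals mulmxA zT mul0mx.
pose y3 : 'M[rat]_(1 + (1 + 1), N + N) :=
  col_mx yQ (col_mx (yQ *m pullR rat) (yQ *m pullR rat *m pullR rat)).
have y3C : y3 *m closing rat o = 0.
  by rewrite /y3 !mul_col_mx yQC (stC _ yQC) (stC _ (stC _ yQC)) !col_mx0.
have y3T : y3 *m totals rat N = 0.
  by rewrite /y3 !mul_col_mx yQT (stT _ yQT) (stT _ (stT _ yQT)) !col_mx0.
have [al al0 alD] := cocycle_dependence N0 (good_connected o_good) (good_corner o_good)
  moved y3C y3T.
have dep : exists2 al : 'rV[rat]_3, al != 0 &
  ((al 0 0 *: (yQ : 'rV_n.+1) + al 0 1 *: (yQ *m PR rat) + al 0 2%:R *: (yQ *m PR rat *m PR rat))%R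
   <= (cobound rat o : 'M_(N'.+1, n.+1)))%MS.
  exists al => //; move: alD; congr (_ <= _)%MS.
  exact: row_mul_col3.
have stD : stablemx (cobound rat o : 'M_(N'.+1, n.+1)) (PR rat).
  have -> : (cobound rat o : 'M_(N'.+1, n.+1)) *m PR rat = permop rat s *m cobound rat o.
    exact: cobound_pullR.
  exact: submxMl.
have [q [mq sq yq qP]] := integral_annihilator stD dep.
exists q; split=> //; apply/eqP=> qM; case/negP: yD.
apply: (sub_cobound_of_quadratic_in algR) => //.
move: yq; rewrite qM char_poly_lin.
rewrite rmorphD rmorphB /= map_polyZ map_polyXn map_polyX map_polyC /=.
rewrite rmorphD rmorphB /= horner_mxZ rmorphXn /= horner_mx_X horner_mx_C expr2.
rewrite mulmxDr mulmxBr -scalemxAr -mulmxE mulmxA rmorph1 mulmx1.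
by [].
Qed.

Lemma vec2_surj (R : nzRingType) (u : 'rV[R]_(1 + 1)) : u = vec2 (u 0 0) (u 0 1).
Proof.
apply/rowP=> k; have [e0 e1] := vec2E (u 0 0) (u 0 1).
case: (split_ordP k) => j ->; rewrite !ord1.
  have -> : lshift 1 0 = 0 :> 'I_(1 + 1) by apply: val_inj.
  by rewrite e0.
have -> : rshift 1 0 = 1 :> 'I_(1 + 1) by apply: val_inj.
by rewrite e1.
Qed.

(** Let [c0] be an integral cocycle with totals [v].  Then N c0 - v has zero totals, where
    [v] stands for the corresponding constant cocycle, and it is annihilated by some q.
    So N q(P) c0 is the constant cocycle q(M) v up to a coboundary.  Evaluated on the loops
    with displacements (nu, 0) and (0, nu), it shows that [N] divides nu times each coordinate
    of q(M) v, which is a non-zero vector, bounded by [ell1_horner]. *)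
Lemma squares_bound : N%:Z <= nu%:Z * ((2 * S) ^+ 2 * nu%:Z).
Proof.
have [c0 [cC cT]] := Per_cocycle (good_corner o_good) (good_Per o_good (0, 1)).
have {}cT : c0 *m totals int N = vec2 nu%:Z 0.
  rewrite cT; congr vec2.
    by rewrite (raddfMn snd) /= natz.
  by rewrite (raddfMn fst) /= mul0rn oppr0.
pose y := N%:Z *: c0 - v *m consts int N.
have yC : y *m closing int o = 0.
  by rewrite mulmxBl -scalemxAl cC scaler0 -mulmxA consts_closing mulmx0 subr0.
have yT : y *m totals int N = 0.
  by rewrite mulmxBl -scalemxAl cT -mulmxA consts_total mul_mx_scalar natz subrr.
have [q [mq sq qM yq qP]] := exists_annihilator yC yT.
pose vq : 'rV[int]_2 := v *m horner_mx M q.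
pose cq : 'rV[int]_(N + N) := (c0 : 'rV_n.+1) *m horner_mx P q.
have vq0 : vq != 0 by apply: v_horner_neq0.
have yqE : (y : 'rV_n.+1) *m horner_mx P q = N%:Z *: cq - vq *m consts int N.
  rewrite /y /vq -mulmxA -consts_horner mulmxA.
  by rewrite [LHS]mulmxBl -scalemxAl.
have [g eg] : exists g : 'rV[rat]_N, N%:R *: map_mx intr cq =
    map_mx intr (vec2 (vq 0 0) (vq 0 1)) *m consts rat N + g *m cobound rat o.
  move: yq; rewrite -map_horner_mx -map_mxM yqE => /submxP[g e]; exists g.
  move: e; rewrite map_mxB map_mxZ => <-.
  have -> : map_mx (intr : int -> rat) (vq *m consts int N) = map_mx intr vq *m consts rat N.
    rewrite -(map_consts rat); exact: (map_mxM _ (vq : 'rV_(1 + 1)) (consts int N)).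
  by rewrite -vec2_surj addrC subrK.
have [m1 e1] := Per_eval eg (good_Per o_good (1, 0)).
have [m2 e2] := Per_eval eg (good_Per o_good (0, 1)).
move: e1 e2; rewrite !(raddfMn fst) !(raddfMn snd) /= !mul0rn !mulr0 addr0 add0r !natz => e1 e2.
have S_ge1 : (1 : algC) <= S%:~R by rewrite ler1z /S; lia.
have bnd : `|vq 0 0| + `|vq 0 1| <= (2 * S) ^+ 2 * nu%:Z.
  have eP mu : eigenvalue (map_mx (intr : int -> algC) P) mu -> `|mu| <= S%:~R by apply: eigen_bound.
  have := @ell1_horner n 1 P q M S%:~R mq sq qP eP S_ge1 lin_word_norm1 (map_mx intr v).
  have n1 (u : 'rV[int]_2) : ell1 (map_mx intr u) = (`|u 0 0| + `|u 0 1|)%:~R.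
    rewrite /ell1 big_ord_recl big_ord1 !mxE rmorphD /= -!intr_norm.
    by congr (`|_|%:~R + `|u _ _|%:~R); exact: val_inj.
  rewrite -map_horner_mx -map_mxM !n1 -/vq.
  have [-> ->] := vec2E nu%:Z (0 : int).
  rewrite normr0 addr0 (ger0_norm (_ : 0 <= nu%:Z)) //.
  rewrite (_ : 2 * S%:~R = (2 * S)%:~R :> algC); last by rewrite rmorphM.
  by rewrite -rmorphXn -rmorphM ler_int.
have x0y0 : (vq 0 0 != 0) || (vq 0 1 != 0).
  rewrite -negb_and; apply: contra vq0 => /andP[/eqP x0 /eqP y0].
  by rewrite [vq]vec2_surj x0 y0 vec2_0.
have key (x m : int) : N%:Z * m = x * nu%:Z -> x != 0 -> `|x| <= (2 * S) ^+ 2 * nu%:Z ->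
    N%:Z <= nu%:Z * ((2 * S) ^+ 2 * nu%:Z).
  move=> e x0 xb; apply: (@le_trans _ _ (nu%:Z * `|x|)); last by rewrite ler_pM2l ?ltz_nat.
  have m0 : m != 0.
    apply: contra x0 => /eqP m0; move: e; rewrite m0 mulr0 => /esym/eqP.
    by rewrite mulf_eq0 eqz_nat (gtn_eqF nu_gt0) orbF.
  have := congr1 (fun z => `|z|) e; rewrite !normrM mulrC [_ * `|x|]mulrC => <-.
  have : 1 <= `|m| by rewrite -gtz0_ge1 normr_gt0.
  move=> m1'; rewrite mulrC; apply: ler_peMr => //.
case/orP: x0y0 => h.
  by apply: (key _ m1 e1 h); apply: le_trans bnd; rewrite lerDl.
by apply: (key _ m2 e2 h); apply: le_trans bnd; rewrite lerDr.
Qed.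

End KeyBound.

(** * From the stabiliser to the genus *)

Section Stabiliser.
Local Open Scope ring_scope.
Variable N : nat.
Implicit Types (o : sqpair N) (A B g : 'M[int]_2).

(** A non-negative hyperbolic matrix of trace t has entries of sum at most t + t^2. *)
Definition squares_max (nu : nat) (t : int) : int := nu%:Z * ((2 * (t + t ^+ 2)) ^+ 2 * nu%:Z).

Lemma squares_max_le nu t t' : 0 <= t <= t' -> squares_max nu t <= squares_max nu t'.
Proof.
case/andP=> t0 tt'; have t'0 := le_trans t0 tt'.
have le2 : t ^+ 2 <= t' ^+ 2 by rewrite ler_pXn2r // nnegrE.
rewrite /squares_max; apply: ler_wpM2l => //; apply: ler_wpM2r => //.
rewrite ler_pXn2r ?nnegrE ?mulr_ge0 ?addr_ge0 ?exprn_ge0 //.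
by rewrite ler_wpM2l // lerD.
Qed.

(** The stabilised origami may be replaced by the one in its orbit that a positive word
    fixes, as [good] is invariant along orbits. *)
Lemma hyperbolic_bound nu o A : (0 < N)%N -> (0 < nu)%N -> good nu o ->
  sl2z_act A o o -> 3 <= \tr A -> N%:Z <= squares_max nu (\tr A).
Proof.
move=> N0 nu0 go aA tA; have [B [o1 [w [aB ow trw]]]] := hyperbolic_word aA tA.
have go1 := good_act aB go.
have [a [b [c [d [linE matE [a0 b0 c0 d0] det [wt wf]]]]]] := lin_word_mx2 w.
move: trw; rewrite matE tr_mx2 => trE.
have [s es] := iso_sym ow.
have tr3 : 3 <= a + d by rewrite addrC trE.
have bc : 0 < b * c.
  have bc0 := mulr_ge0 b0 c0.
  have a1 : a != 0 by apply/eqP=> ea; move: det; rewrite ea mul0r; lia.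
  have d1 : d != 0 by apply/eqP=> ed; move: det; rewrite ed mulr0; lia.
  have ad : 0 <= (a - 1) * (d - 1) by apply: mulr_ge0; lia.
  by move: det tr3 ad; rewrite mulrBl !mulrBr; lia.
have bn0 : b != 0 by apply: contraTneq bc => ->; rewrite mul0r.
have cn0 : c != 0 by apply: contraTneq bc => ->; rewrite mulr0.
have b1 : 0 < b by rewrite lt_def bn0.
have c1 : 0 < c by rewrite lt_def cn0.
have tw : true \in w by apply: contraNT bn0 => /wt ->.
have fw : false \in w by apply: contraNT cn0 => /wf ->.
case: N N0 o A go aA tA B o1 w aB ow go1 linE matE wt wf tw fw s es trE => // N' _ o A _ _ _ B o1 w
  _ _ go1 linE _ _ _ tw fw s es trE.
have /le_trans := squares_bound nu0 go1 es linE a0 b1 c1 d0 det tr3 tw fw; apply.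
rewrite /squares_max -trE; apply: ler_wpM2l => //; apply: ler_wpM2r => //.
have e0 : 0 <= a + b + c + d by rewrite !addr_ge0 // ltW.
(* As b and c are positive, b + c <= b c + 1 = a d. *)
have e1 : a + b + c + d <= d + a + (d + a) ^+ 2 by nia.
rewrite ler_pXn2r ?nnegrE ?mulr_ge0 //; first by rewrite ler_wpM2l.
exact: le_trans e1.
Qed.

Lemma invmx_opp A : sl2 A -> invmx (- A) = - invmx A.
Proof.
move=> sA; have u := sl2_unit (sl2N sA); apply: (can_inj (mulKmx u)).
by rewrite mulmxV // mulNmx mulmxN opprK mulmxV // sl2_unit.
Qed.

Variable o : sqpair N.
Let Gam := SL_stab o.

(** The origamis to which [A^-1], up to sign, carries [o]: they determine the coset of [A]
    for the stabiliser of [o] and -1. *)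
Definition reach A : {set sqpair N} :=
  [set o' | `[< sl2z_act (invmx A) o o' \/ sl2z_act (- invmx A) o o' >]]%SET.

Lemma reach_sub g A B : sl2z_act g o o -> sl2 A -> sl2 B -> B = g *m A \/ B = - (g *m A) ->
  reach A \subset reach B.
Proof.
move=> ag sA sB e; apply/fintype.subsetP=> o'; rewrite !inE => h.
have ag' := sl2z_act_inv ag; have sg := sl2z_act_sl2 ag.
have eV : invmx (g *m A) = invmx A *m invmx g by apply: invmx_mul.
have sgA := sl2M sg sA.
case: e => ->; rewrite ?(invmx_opp sgA) eV.
  by case: h => h; [left|right; rewrite -mulNmx]; apply: sl2z_act_mul ag' h.
by case: h => h; [right; rewrite opprK|left; rewrite -mulNmx]; apply: sl2z_act_mul ag' h.
Qed.

Lemma reachP A B : sl2 A -> sl2 B ->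
  (reach A = reach B <-> exists g, Gam g /\ (B = g *m A \/ B = - (g *m A))).
Proof.
move=> sA sB; split=> [e|[g [ag e]]]; last first.
  apply/eqP; rewrite finset.eqEsubset (reach_sub ag) //=.
  have sg := sl2z_act_sl2 ag.
  apply: (reach_sub (sl2z_act_inv ag)) => //.
  by case: e => ->; [left; rewrite mulKmx ?sl2_unit|right; rewrite mulmxN mulKmx ?opprK ?sl2_unit].
have [o' ao'] := sl2z_act_total o (sl2V sA).
have : o' \in reach B by rewrite -e !inE; left.
rewrite !inE => -[] /sl2z_act_inv; rewrite ?invmx_opp ?invmxK; try exact: sl2V.
  move=> aB; exists (B *m invmx A); split; first exact: sl2z_act_mul ao' aB.
  by left; rewrite mulmxKV // sl2_unit.
move=> aB; exists (- B *m invmx A); split; first exact: sl2z_act_mul ao' aB.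
by right; rewrite mulmxKV ?opprK // sl2_unit.
Qed.

Definition reachable : {pred {set sqpair N}} := fun U => `[< exists A, sl2 A /\ reach A = U >].

Lemma reach1P : reach 1%:M \in reachable.
Proof. by apply/asboolP; exists 1%:M; split=> //; apply: sl21. Qed.

Definition coset_type := {U : {set sqpair N} | U \in reachable}.

Definition coset_point A : coset_type :=
  insubd (Sub (reach 1%:M) reach1P : coset_type) (reach A).

Lemma val_coset_point A : sl2 A -> val (coset_point A) = reach A.
Proof. by move=> sA; rewrite insubdK //; apply/asboolP; exists A. Qed.

(** An element of trace less than -2 is squared to get a trace larger than 2, which is why
    the bound is taken at the square of [tau]. *)
Lemma genus_of_stab nu (G : nat) (tau : int) : (0 < N)%N -> (0 < nu)%N -> good nu o ->
  2 + (24 * (G + 1)%:Z) ^+ 2 <= tau -> 2 + 48 ^+ 4 <= tau ->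
  squares_max nu (tau ^+ 2) < N%:Z ->
  exists g : nat, has_genus Gam g /\ (G <= g)%N.
Proof.
move=> N0 nu0 go hG h48 hN.
have tau0 : 2 <= tau by apply: le_trans h48; rewrite lerDl.
have tau2 : tau <= tau ^+ 2 by nia.
have Gsl2 g : Gam g -> sl2 g by apply: sl2z_act_sl2.
have Gtr g : Gam g -> 2 < \tr g <= tau ^+ 2 -> False.
  move=> ag /andP[t2 tt].
  have := hyperbolic_bound N0 nu0 go ag t2; rewrite leNgt => /negP; apply.
  apply: le_lt_trans hN; apply: squares_max_le; rewrite tt andbT.
  by apply: le_trans (ltW t2).
apply: (genus_large (K := coset_point) (tau := tau) Gsl2 _ _ _ _ hG h48).
- move=> U; have /asboolP[A [sA eA]] := valP U; exists A; split=> //.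
  by apply: val_inj; rewrite val_coset_point.
- move=> A B sA sB; rewrite -(reachP sA sB); split=> [/(congr1 val)|e].
    by rewrite !val_coset_point.
  by apply: val_inj; rewrite !val_coset_point.
- by move=> g ag /andP[t2 tt]; apply: (Gtr g ag); rewrite t2 (le_trans tt tau2).
- move=> g ag /andP[t2 tt]; apply: (Gtr (g *m g) (sl2z_act_mul ag ag)).
  have := Gsl2 g ag; rewrite [g]mx2E /sl2 det_mx2 in t2 tt *.
  move: t2 tt; rewrite mul_mx2 !tr_mx2.
  move: (g 0 0) (g 0 1) (g 1 0) (g 1 1) => a b c d t2 tt det.
  have -> : a * a + b * c + (c * b + d * d) = (a + d) ^+ 2 - 2 by nia.
  by apply/andP; split; nia.
Qed.

End Stabiliser.

Lemma H11_corner N (o : sqpair N) : in_H11 o -> corner_inv o /\ moved_by_two (corner o).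
Proof.
rewrite /in_H11; set k := corner o.
set L := [seq C <- _ | _] => /[dup] /perm_size; rewrite size_map /= => szL /perm_mem memL.
have LP (C : {set 'I_N}) : C \in porbits k -> (1 < #|C|)%N -> C \in L.
  by move=> CP C1; rewrite mem_filter C1 mem_enum.
have card2 C : C \in L -> #|C| = 2%N.
  move=> CL; have := memL #|C|; rewrite map_f // !inE orbb => /esym/eqP; exact.
have k2 i : k (k i) = i.
  have [sz1|sz1] := leqP #|porbit k i| 1.
    have e : #|porbit k i| = 1%N by apply/eqP; rewrite eqn_leq sz1 lt0n card_porbit_neq0.
    by have := iter_porbit k i; rewrite e /= => ->; rewrite -{2}(iter_porbit k i) e.
  have e := card2 _ (LP _ (imset_f _ _) sz1).
  by have := iter_porbit k i; rewrite e.
have kk : (k * k = 1)%g by apply/permP=> i; rewrite permM k2 perm1.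
split=> //.
have orb p i : i \in porbit k p -> i = p \/ i = k p.
  case/porbitP=> n ->; rewrite -(odd_double_half n) expgD -muln2 mulnC expgM.
  rewrite (expgS k 1) expg1 kk expg1n mulg1.
  by case: (odd n); [right; rewrite expg1|left; rewrite expg0 perm1].
case: L szL LP card2 memL => [|C1 [|C2 [|]]] //= _ LP card2 _.
have in1 (C : {set 'I_N}) : #|C| = 2%N -> exists p, forall i, C = porbit k i -> i \in [:: p; k p].
  move=> sz; have /card_gt0P[p pC] : (0 < #|C|)%N by rewrite sz.
  exists p => i e; move: pC; rewrite e porbit_sym => /orb[] ->; by rewrite !inE eqxx ?orbT.
have [p hp] := in1 C1 (card2 C1 (mem_head _ _)).
have [r hr] := in1 C2 (card2 C2 (mem_last C1 [:: C2])).
exists p, r => i mi.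
have sz : (1 < #|porbit k i|)%N.
  rewrite (cardsD1 i) porbit_id ltnS; apply/card_gt0P; exists (k i).
  by rewrite !inE mi; have := mem_porbit k 1 i; rewrite expg1.
have := LP _ (imset_f _ isT) sz; rewrite in_cons mem_seq1 => /orP[] /eqP /esym.
  by move/hp; rewrite !inE => /orP[] ->; rewrite ?orbT.
by move/hr; rewrite !inE => /orP[] ->; rewrite ?orbT.
Qed.

Theorem theorem1p13 (n : nat) (n_ge1 : (1 <= n)%N)
    (Zmiaikou : Zmiaikou_conjecture) (Parity : Parity_conjecture) :
  forall G : nat, exists D : nat, forall d : nat, (2 <= d)%N -> (D <= d)%N ->
  forall C : {set {set sqpair (d * n)}}, C \in W_components d n ->
  forall o : sqpair (d * n), iso_class o \in C ->
  exists g : nat, has_genus (SL_stab o) g /\ (G <= g)%N.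
Proof.
move=> G.
(* The first summand of [tau] forces the genus up, the second one makes exceptional
   points rare.  The absolute periods have index n, so n! kills the quotient. *)
pose tau : int := (2 + (24 * (G + 1)%:Z) ^+ 2 + (2 + 48 ^+ 4))%R.
exists `|squares_max n`! (tau ^+ 2)|%N.+1 => d d2 Dd C /imsetP[o0].
rewrite inE => /andP[o0tr /andP[/H11_corner[ci cm] /asboolP[RP idx]]] -> o /imsetP[o' + e].
rewrite inE => /asboolP[A a0].
have [s es] : exists s, o = conj_pair o' s.
  have : o \in iso_class o by apply/imsetP; exists 1%g; rewrite ?conj_pair1.
  by rewrite e => /imsetP[s _ ->]; exists s.
have a : sl2z_act A o0 o by apply: sl2z_act_isor a0 _; exists s.
have go0 : good n`! o0.
  split=> //; first exact: connected_origamis.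
  move=> z; apply: has_index_fact; first exact: subgroup_generated_subgroup.
  by rewrite -RP.
apply: (genus_of_stab (tau := tau) _ _ (good_act a go0)).
- by rewrite muln_gt0 (ltnW d2).
- exact: fact_gt0.
- by rewrite /tau lerDl addr_ge0.
- by rewrite /tau lerDr addr_ge0 // exprn_even_ge0.
- apply: le_lt_trans (lez_abs _) _; rewrite ltz_nat; apply: leq_trans Dd _.
  by rewrite leq_pmulr.
Qed.
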